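(* An $\mathrm{SU}(2)$-invariant affine connection $\nabla$ on $\mathbb{S}^3$ is metric if and only if there are $t_{ij}\in\mathbb{R}$, $i,j\in\{1,2,3\}$, such that $$\nabla_XY=\nabla^g_XY+\sum_{i,j=1}^3t_{ij}E_i^\flat(X)\sigma^j(Y)$$ for all $X,Y\in\mathfrak{X}(\mathbb{S}^3)$. Moreover, such a (metric) $\nabla$ has totally skew-symmetric torsion if and only if there is $r\in\mathbb{R}$ such that $$\nabla_XY=\nabla^g_XY+r\big(\Phi(X,Y)\xi-\eta(X)\psi(Y)+\eta(Y)\psi(X)\big)$$ for all $X,Y\in\mathfrak{X}(\mathbb{S}^3)$. Every metric $\mathrm{SU}(2)$-invariant connection on $\mathbb{S}^3$ with totally skew-symmetric torsion satisfies the $\nabla$-Einstein equation, with $$\mathrm{Sym}(\mathrm{Ric}^\nabla)=2(1-r^2)\,g,$$ where $r$ is the parameter in the previous formula.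
   Context: $\mathrm{SU}(2)$ acts on the unit sphere $\mathbb{S}^3\subset\mathbb{C}^2$ by matrix multiplication; write $\tau_\sigma(p)=\sigma p$. For a vector field $X$, $\tau_\sigma(X)_p=(\tau_\sigma)_*(X_{\sigma^{-1}p})$. An affine connection $\nabla$ is $\mathrm{SU}(2)$-invariant if $\tau_\sigma(\nabla_XY)=\nabla_{\tau_\sigma(X)}\tau_\sigma(Y)$ for all $\sigma\in\mathrm{SU}(2)$ and all vector fields $X,Y$. $g$ is the canonical Riemannian metric of constant sectional curvature $1$ and $\nabla^g$ its Levi-Civita connection. $\nabla$ is metric if $\nabla g=0$ (its torsion need not vanish). Its torsion is $T^\nabla(X,Y)=\nabla_XY-\nabla_YX-[X,Y]$, and $\nabla$ has totally skew-symmetric torsion if $\omega_\nabla(X,Y,Z)=g(T^\nabla(X,Y),Z)$ is a $3$-form. Sasakian structure: $\xi_z=-\mathbf{i}z$; with $N$ the unit outward normal, $\psi,\eta$ are determined by the decomposition $\mathbf{i}X=\psi(X)+\eta(X)N$ into tangent and normal parts; $\Phi(X,Y)=g(X,\psi(Y))$. Let $o=(0,1)\in\mathbb{S}^3$ and identify $\mathrm{SU}(2)$ with $\mathbb{S}^3$ by $\sigma\mapsto\sigma\cdot o$. Let $$E_1=\begin{pmatrix}0&1\\-1&0\end{pmatrix},\quad E_2=\begin{pmatrix}0&\mathbf{i}\\\mathbf{i}&0\end{pmatrix},\quad E_3=\begin{pmatrix}-\mathbf{i}&0\\0&\mathbf{i}\end{pmatrix}\in\mathfrak{su}(2),$$ and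 denote by the same letters the corresponding left-invariant vector fields on $\mathbb{S}^3$, i.e. $(E_i)_{\sigma\cdot o}=\sigma E_i\,o$; they form a global orthonormal frame, with $E_3=-\xi$ and $\psi(E_1)=E_2$. $E_i^\flat=g(E_i,-)$. Define the $(1,1)$-tensors $$\sigma^3=E_1^\flat\otimes E_2-E_2^\flat\otimes E_1,\quad \sigma^1=E_2^\flat\otimes E_3-E_3^\flat\otimes E_2,\quad \sigma^2=E_3^\flat\otimes E_1-E_1^\flat\otimes E_3,$$ where $(\alpha\otimes V)(Y)=\alpha(Y)V$. Curvature: $R^\nabla(X,Y)Z=\nabla_X\nabla_YZ-\nabla_Y\nabla_XZ-\nabla_{[X,Y]}Z$, $\mathrm{Ric}^\nabla(Y,Z)=\mathrm{tr}(X\mapsto R^\nabla(X,Y)Z)$, $s^\nabla$ is the $g$-trace of $\mathrm{Ric}^\nabla$, and $\mathrm{Sym}$ denotes the symmetric part. A metric connection $\nabla$ with totally skew-symmetric torsion satisfies the $\nabla$-Einstein equation on $(M,g)$ if $\mathrm{Sym}(\mathrm{Ric}^\nabla)=\frac{s^\nabla}{\dim M}g$. *)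

(* Defs.v *)
From HB Require Import structures.
From mathcomp Require Import all_boot all_order all_algebra.
From mathcomp Require Import sesquilinear spectral complex ring.
From mathcomp Require Import all_classical all_reals all_analysis.

Set Implicit Arguments.
Unset Strict Implicit.
Unset Printing Implicit Defensive.

Import Order.TTheory GRing.Theory Num.Theory Num.Def.
Import numFieldNormedType.Exports.

Local Open Scope classical_set_scope.
Local Open Scope ring_scope.
Local Open Scope sesquilinear_scope.

(* [U] is meant to be open. *)
Fixpoint Ck (R : realType) (V : normedModType R) (k : nat)
    (U : set V) (F : V -> R) : Prop :=
  if k is k'.+1 then
    (forall x, U x -> differentiable F x) /\
    (forall v : V, Ck k' U (fun x => 'D_v F x))
  else forall x, U x -> {for x, continuous F}.

Section Sphere.
Variable R : realType.

Definition col2 (a b : R[i]) : 'cV[R[i]]_2 :=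
  \col_k (if k == 0 then a else b).

Definition mx22 (a b c d : R[i]) : 'M[R[i]]_2 :=
  \matrix_(k, l) (if k == 0 then (if l == 0 then a else b)
                  else (if l == 0 then c else d)).

(* The real inner product of C^2 = R^4; on tangent vectors of the unit sphere
   it is the canonical metric of curvature 1. *)
Definition g (u v : 'cV[R[i]]_2) : R := complex.Re ((u^T *m map_mx conjC v) 0 0).

Definition rscale (a : R) (u : 'cV[R[i]]_2) : 'cV[R[i]]_2 := real_complex R a *: u.

Definition S3 : Type := {p : 'cV[R[i]]_2 | g p p == 1}.

Definition pt (p : S3) : 'cV[R[i]]_2 := val p.

Definition coords (u : 'cV[R[i]]_2) : 'rV[R]_4 :=
  \row_k tnth [tuple complex.Re (u 0 0); complex.Im (u 0 0);
                     complex.Re (u 1 0); complex.Im (u 1 0)] k.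

Definition smooth (f : S3 -> R) : Prop :=
  forall p : S3, exists (U : set 'rV[R]_4) (F : 'rV[R]_4 -> R),
    [/\ open U, U (coords (pt p)), (forall k, Ck k U F) &
        forall q : S3, U (coords (pt q)) -> f q = F (coords (pt q))].

Definition field : Type := S3 -> 'cV[R[i]]_2.

Definition vf (X : field) : Prop :=
  (forall p, g (pt p) (X p) = 0) /\
  (forall k, smooth (fun p => complex.Re (X p k 0)) /\
             smooth (fun p => complex.Im (X p k 0))).

Definition fadd (X Y : field) : field := fun p => X p + Y p.
Definition fsub (X Y : field) : field := fun p => X p - Y p.
Definition fscale (f : S3 -> R) (X : field) : field := fun p => rscale (f p) (X p).
Definition gf (X Y : field) : S3 -> R := fun p => g (X p) (Y p).

(* For [v] tangent at [p], the curve t |-> (p + t v) / |p + t v| of the sphere,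
   of velocity [v] at t = 0.  The default value [p] of [insubd] is not used,
   since then |p + t v| >= 1. *)
Definition curve (p : S3) (v : 'cV[R[i]]_2) (t : R) : S3 :=
  let w := pt p + rscale t v in insubd p (rscale (Num.sqrt (g w w))^-1 w).

Definition dirder (f : S3 -> R) (p : S3) (v : 'cV[R[i]]_2) : R :=
  derive1 (fun t => f (curve p v t)) 0.

Definition act (X : field) (f : S3 -> R) : S3 -> R := fun p => dirder f p (X p).

(* X applied to each of the four real components of Y. *)
Definition actf (X Y : field) : field := fun p =>
  \col_k Complex (act X (fun q => complex.Re (Y q k 0)) p)
                 (act X (fun q => complex.Im (Y q k 0)) p).

(* [X, Y](f) = X(Y(f)) - Y(X(f)), where f runs over the four real coordinate
   functions of R^4 restricted to the sphere (Y(x_k) is the k-th component of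
   Y). *)
Definition bracket (X Y : field) : field := fsub (actf X Y) (actf Y X).

(* Only the values on pairs of elements of X(S^3) are meaningful. *)
Definition conn : Type := field -> field -> field.

Definition affine_connection (nabla : conn) : Prop :=
  [/\ forall X Y, vf X -> vf Y -> vf (nabla X Y),
      forall X X' Y, vf X -> vf X' -> vf Y ->
        nabla (fadd X X') Y = fadd (nabla X Y) (nabla X' Y),
      forall f X Y, smooth f -> vf X -> vf Y ->
        nabla (fscale f X) Y = fscale f (nabla X Y),
      forall X Y Y', vf X -> vf Y -> vf Y' ->
        nabla X (fadd Y Y') = fadd (nabla X Y) (nabla X Y') &
      forall f X Y, smooth f -> vf X -> vf Y ->
        nabla X (fscale f Y) =
          fadd (fscale (act X f) Y) (fscale f (nabla X Y))].

Definition metric (nabla : conn) : Prop :=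
  forall X Y Z, vf X -> vf Y -> vf Z -> forall p,
    act X (gf Y Z) p = gf (nabla X Y) Z p + gf Y (nabla X Z) p.

Definition torsion (nabla : conn) (X Y : field) : field :=
  fsub (fsub (nabla X Y) (nabla Y X)) (bracket X Y).

Definition levi_civita (nabla : conn) : Prop :=
  [/\ affine_connection nabla, metric nabla &
      forall X Y, vf X -> vf Y -> forall p, torsion nabla X Y p = 0].

Definition three_form (w : field -> field -> field -> S3 -> R) : Prop :=
  [/\ forall X Y Z, vf X -> vf Y -> vf Z -> smooth (w X Y Z),
      forall f X X' Y Z, smooth f -> vf X -> vf X' -> vf Y -> vf Z ->
        forall p, [/\
          w (fadd (fscale f X) X') Y Z p = f p * w X Y Z p + w X' Y Z p,
          w Y (fadd (fscale f X) X') Z p = f p * w Y X Z p + w Y X' Z p &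
          w Y Z (fadd (fscale f X) X') p = f p * w Y Z X p + w Y Z X' p] &
      forall X Y, vf X -> vf Y ->
        forall p, [/\ w X X Y p = 0, w X Y Y p = 0 & w X Y X p = 0]].

Definition skew_torsion (nabla : conn) : Prop :=
  three_form (fun X Y Z => gf (torsion nabla X Y) Z).

Definition SU2 : Type :=
  {s : 'M[R[i]]_2 | (s \is unitarymx) && (\det s == 1)}.

Definition su2mx (s : SU2) : 'M[R[i]]_2 := val s.

Lemma su2_invP (s : SU2) :
  ((su2mx s) ^t* \is unitarymx) && (\det ((su2mx s) ^t*) == 1).
Proof.
case: s => s sP; rewrite /su2mx /=; have /andP[us /eqP ds] := sP.
by rewrite trmxC_unitary us det_map_mx det_tr ds rmorph1 /=.
Qed.

Definition su2_inv (s : SU2) : SU2 := exist _ ((su2mx s) ^t*) (su2_invP s).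

Lemma su2_invE (s : SU2) : su2mx (su2_inv s) = invmx (su2mx s).
Proof. by have /andP[us _] := valP s; rewrite invmx_unitary. Qed.

Lemma g_unitary (s : 'M[R[i]]_2) (u v : 'cV[R[i]]_2) :
  s \is unitarymx -> g (s *m u) (s *m v) = g u v.
Proof.
rewrite -trmx_unitary => /unitarymxP us; rewrite /g trmx_mul map_mxM.
have h : s^T *m map_mx conjC s = 1%:M by rewrite -[RHS]us trmxK.
by rewrite mulmxA -(mulmxA u^T) h mulmx1.
Qed.

Lemma tauP (s : SU2) (p : S3) : g (su2mx s *m pt p) (su2mx s *m pt p) == 1.
Proof. by have /andP[us _] := valP s; rewrite g_unitary //; exact: (valP p). Qed.

Definition tau (s : SU2) (p : S3) : S3 := exist _ (su2mx s *m pt p) (tauP s p).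

(* The differential of the restriction [tau s] of a linear map is
   multiplication by [s]. *)
Definition push (s : SU2) (X : field) : field :=
  fun p => su2mx s *m X (tau (su2_inv s) p).

Definition SU2_invariant (nabla : conn) : Prop :=
  forall (s : SU2) X Y, vf X -> vf Y ->
    push s (nabla X Y) = nabla (push s X) (push s Y).

Definition imul (u : 'cV[R[i]]_2) : 'cV[R[i]]_2 := Complex 0 1 *: u.

Definition xi : field := fun p => - imul (pt p).

(* The unit outward normal at p is p itself. *)
Definition eta (X : field) : S3 -> R := fun p => g (imul (X p)) (pt p).

Definition psi (X : field) : field :=
  fun p => imul (X p) - rscale (eta X p) (pt p).

Definition Phi (X Y : field) : S3 -> R := gf X (psi Y).

Lemma mx22_det (a b c d : R[i]) : \det (mx22 a b c d) = a * d - b * c.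
Proof.
rewrite (expand_det_row _ 0) !big_ord_recl big_ord0 /cofactor !det_mx11 !mxE /=.
by rewrite addr0 expr0 expr1 mul1r mulN1r mulrN.
Qed.

Lemma sum2 (F : 'I_2 -> R[i]) : \sum_k F k = F 0 + F 1.
Proof. by rewrite big_ord_recl big_ord1; congr (_ + F _); apply/val_inj. Qed.

Definition base : 'cV[R[i]]_2 := col2 0 1.

Definition E1mx : 'M[R[i]]_2 := mx22 0 1 (- 1) 0.
Definition E2mx : 'M[R[i]]_2 := mx22 0 (Complex 0 1) (Complex 0 1) 0.
Definition E3mx : 'M[R[i]]_2 := mx22 (- Complex 0 1) 0 0 (Complex 0 1).

(* The inverse of the identification s |-> s *m base of SU(2) with the sphere;
   see [su2_ofP], [su2_ofK] and [left_fieldE]. *)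
Definition su2_of (p : S3) : 'M[R[i]]_2 :=
  mx22 (conjC (pt p 1 0)) (pt p 0 0) (- conjC (pt p 0 0)) (pt p 1 0).

Lemma pt_norm (p : S3) :
  pt p 0 0 * conjC (pt p 0 0) + pt p 1 0 * conjC (pt p 1 0) = 1.
Proof.
have := eqP (valP p); rewrite /g mxE sum2 !mxE -/(pt p) /=.
case: (pt p 0 0) (pt p 1 0) => [a b] [c d] /= h.
by apply/eqP; rewrite eq_complex /=; apply/andP; split; apply/eqP;
  [rewrite -h; ring | ring].
Qed.

Lemma su2_ofP (p : S3) : (su2_of p \is unitarymx) && (\det (su2_of p) == 1).
Proof.
have h := pt_norm p; apply/andP; split; last first.
  by rewrite mx22_det -h; apply/eqP; ring.
apply/unitarymxP/matrixP => k l; rewrite !mxE sum2 !mxE.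
case: k => [[|[|//]] ?]; case: l => [[|[|//]] ?] /=;
  rewrite ?rmorphN /= ?conjCK ?mulr1n ?mulr0n -?h /=; ring.
Qed.

Lemma su2_ofK (p : S3) : su2_of p *m base = pt p.
Proof.
apply/matrixP => k l; rewrite !mxE sum2 !mxE !ord1 /= mulr0 add0r mulr1.
by case: k => [[|[|//]] ?] /=; congr (pt p _ _); apply/val_inj.
Qed.

Definition left_field (A : 'M[R[i]]_2) : field := fun p => su2_of p *m A *m base.

Lemma su2_of_tau (s : SU2) (p : S3) :
  su2mx s *m base = pt p -> su2_of p = su2mx s.
Proof.
move=> sp; rewrite /su2_of -sp.
have /andP[/unitarymxP us /eqP ds] := valP s.
have h k l : su2mx s k 0 * conjC (su2mx s l 0) +
             su2mx s k 1 * conjC (su2mx s l 1) = (k == l)%:R.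
  by have := congr1 (fun M : 'M[R[i]]_2 => M k l) us; rewrite !mxE sum2 !mxE.
have {}ds : su2mx s 0 0 * su2mx s 1 1 - su2mx s 0 1 * su2mx s 1 0 = 1.
  by rewrite -mx22_det -[RHS]ds; congr (\det _); apply/matrixP => k l;
    rewrite !mxE; case: k => [[|[|//]] ?]; case: l => [[|[|//]] ?] /=;
    congr (su2mx s _ _); apply/val_inj.
move: {us} (h 0 0) (h 0 1) (h 1 0) (h 1 1); rewrite !mulr1n ?mulr0n.
move=> h00 h01 h10 h11; apply/matrixP => k l; rewrite !mxE !sum2 !mxE /=.
rewrite !mulr0 !mulr1 !add0r.
have lin (a b c d a' b' c' d' : R[i]) : a * d - b * c = 1 ->
    a * a' + b * b' = 1 -> a * c' + b * d' = 0 ->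
    c * a' + d * b' = 0 -> c * c' + d * d' = 1 -> d' = a /\ - b' = c.
  move=> e1 e2 e3 e4 e5; split; apply/eqP; rewrite -subr_eq0; apply/eqP.
    transitivity (- (d' * (a * d - b * c - 1) + c * (a * c' + b * d')
                     - a * (c * c' + d * d' - 1))); first by ring.
    by rewrite e1 e3 e5 !subrr !mulr0 !subr0 addr0 oppr0.
  transitivity (- (- b' * (a * d - b * c - 1) + a * (c * a' + d * b')
                   - c * (a * a' + b * b' - 1))); first by ring.
  by rewrite e1 e2 e4 !subrr !mulr0 !subr0 addr0 oppr0.
have [e0 e1] := lin _ _ _ _ _ _ _ _ ds h00 h01 h10 h11.
case: k => [[|[|//]] ?]; case: l => [[|[|//]] ?] /=; rewrite ?e0 ?e1;
  congr (su2mx s _ _); exact/val_inj.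
Qed.

Lemma left_fieldE (A : 'M[R[i]]_2) (s : SU2) (p : S3) :
  su2mx s *m base = pt p -> left_field A p = su2mx s *m A *m base.
Proof. by move=> /su2_of_tau; rewrite /left_field => ->. Qed.

Definition E1 : field := left_field E1mx.
Definition E2 : field := left_field E2mx.
Definition E3 : field := left_field E3mx.

Definition flat (X Y : field) : S3 -> R := gf X Y.

(* The tensor A^flat (x) B - B^flat (x) A, applied to Y. *)
Definition wedge (A B : field) (Y : field) : field :=
  fsub (fscale (flat A Y) B) (fscale (flat B Y) A).

Definition sigma1 : field -> field := wedge E2 E3.
Definition sigma2 : field -> field := wedge E3 E1.
Definition sigma3 : field -> field := wedge E1 E2.

Definition E (k : 'I_3) : field := tnth [tuple E1; E2; E3] k.
Definition sigma (k : 'I_3) : field -> field :=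
  tnth [tuple sigma1; sigma2; sigma3] k.

Definition curvature (nabla : conn) (X Y Z : field) : field :=
  fsub (fsub (nabla X (nabla Y Z)) (nabla Y (nabla X Z)))
       (nabla (bracket X Y) Z).

(* The trace of X |-> R(X, Y)Z, computed in the g-orthonormal frame E. *)
Definition Ric (nabla : conn) (Y Z : field) : S3 -> R :=
  fun p => \sum_(k < 3) gf (curvature nabla (E k) Y Z) (E k) p.

Definition scal (nabla : conn) : S3 -> R :=
  fun p => \sum_(k < 3) Ric nabla (E k) (E k) p.

Definition SymRic (nabla : conn) (Y Z : field) : S3 -> R :=
  fun p => (Ric nabla Y Z p + Ric nabla Z Y p) / 2.

Definition nabla_Einstein (nabla : conn) : Prop :=
  forall Y Z, vf Y -> vf Z -> forall p,
    SymRic nabla Y Z p = scal nabla p / 3 * gf Y Z p.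

Definition skew_formula (nablag nabla : conn) (r : R) : Prop :=
  forall X Y, vf X -> vf Y -> forall p,
    nabla X Y p = nablag X Y p +
      rscale r (rscale (Phi X Y p) (xi p) - rscale (eta X p) (psi Y p)
                + rscale (eta Y p) (psi X p)).

End Sphere.

(* Main.v *)
(* The left-invariant fields E_k trivialise the tangent bundle, so a connection
   is its Christoffel symbols in this frame. SU(2) acts simply transitively and
   fixes the E_k, so for an invariant connection these symbols are constant.
   Since [E_i, E_j] = -2 E_i x E_j, the Levi-Civita connection is
   X(Y) - X x Y in coordinates, where X(Y) differentiates the components of Y.
   A metric connection differs from it by constants skew in the last two
   indices (the t_ij), and by constants skew in all three when the torsion is
   skew, so that the connection is X(Y) + c X x Y with c = r - 1. Its curvature
   is (c^2 + 2c) (X x Y) x Z, with trace -2 (c^2 + 2c) g = 2 (1 - r^2) g.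

   For components that are arbitrary smooth functions, the curvature computation
   needs [X, Y] f = X (Y f) - Y (X f), while the bracket is only given on the
   coordinate functions. The general case is the chain rule and the symmetry of
   second derivatives of a local extension of f to R^4. The other properties of
   smoothness (that X f is smooth, that [X, Y] is a smooth field) come
   for free from the axioms of the Levi-Civita connection. *)
Require Import Defs.
From mathcomp Require Import all_boot all_order all_algebra complex.
From mathcomp Require Import sesquilinear spectral ring lra.
From mathcomp Require Import all_classical all_reals all_analysis.
Import Order.TTheory GRing.Theory Num.Theory.
Import numFieldNormedType.Exports.
Set Implicit Arguments.
Unset Strict Implicit.
Unset Printing Implicit Defensive.
Local Open Scope classical_set_scope.
Local Open Scope ring_scope.

(** * Smooth functions *)

(** Differentiability depends only on the germ at [x]: the differential of [F], with its little-o
    remainder, serves for [G] as well. *)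
Lemma near_eq_differentiable (R : realType) (V W : normedModType R)
    (F G : V -> W) (x : V) :
  (\near x, F x = G x) -> differentiable F x -> differentiable G x.
Proof.
move=> FG dF; apply/diffP.
(* The differential ['d G x] is obtained by choice, so exhibiting one linear map with these two
   properties suffices. Here [lim (nbhs x)] is just [x]. *)
apply: (@getPex _ (fun (df : {linear V -> W}) => continuous df /\
  forall y, G y = G (lim (nbhs x)) + df (y - lim (nbhs x))
                  +o_(y \near x) (y - lim (nbhs x)))).
exists ('d F x); split; first exact: diff_continuous.
have [_ FE] := (diffP _ _).1 dF.
have {}FE : F = (fun y => F (lim (nbhs x)) + 'd F x (y - lim (nbhs x)))
                +o_ x (fun y => y - lim (nbhs x)).
  by apply/funext => y; exact: FE.
suff GE : G = (fun y => G (lim (nbhs x)) + 'd F x (y - lim (nbhs x)))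
                +o_ x (fun y => y - lim (nbhs x)).
  by move=> y; exact: (congr1 (fun f => f y) GE).
apply/eqaddoP => e e0; move/eqaddoP: FE => /(_ e e0).
rewrite lim_id// -(nbhs_singleton FG); apply: filterS2 FG => y Gy.
by rewrite ![(_ - _ : _ -> _) _]/(_ - _) /= -Gy.
Qed.

Section Ck.
Variables (R : realType) (V : normedModType R).
Implicit Types (U : set V) (F G : V -> R).

(** As [U] is open, [F] and [G] agree near each of its points, so their derivatives agree on [U] and
    the induction continues. *)
Lemma Ck_eq k U F G : open U -> (forall x, U x -> F x = G x) ->
  Ck k U F -> Ck k U G.
Proof.
move=> oU; elim: k F G => [|k IH] F G FG /=.
  move=> cF x Ux; move: (cF x Ux); rewrite /prop_for /continuous_at -FG// => h.
  apply: cvg_trans h; apply: near_eq_cvg.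
  by apply: filterS (open_nbhs_nbhs (conj oU Ux)) => y /FG ->.
move=> [dF DF]; have near_FG x : U x -> \near x, F x = G x.
  by move=> Ux; apply: filterS (open_nbhs_nbhs (conj oU Ux)) => y /FG ->.
split=> [x Ux|v]; first by apply: near_eq_differentiable (dF x Ux); exact: near_FG.
by apply: IH (DF v) => x Ux; apply: near_eq_derive; exact: near_FG.
Qed.

Lemma Ck_subset k U U' F : U' `<=` U -> Ck k U F -> Ck k U' F.
Proof.
move=> U'U; elim: k F => [|k IH] F /=; first by move=> cF x /U'U; exact: cF.
by move=> [dF DF]; split=> [x /U'U/dF|v] //; exact: IH.
Qed.

Lemma CkW k U F : Ck k.+1 U F -> Ck k U F.
Proof.
elim: k F => [|k IH] F [dF DF].
  by move=> x /dF; exact: differentiable_continuous.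
by split=> // v; exact/IH/DF.
Qed.

Lemma Ck_cst k U (c : R) : Ck k U (cst c).
Proof.
elim: k c => [|k IH] c /=; first by move=> x _; exact: cst_continuous.
split=> [x _|v]; first exact: differentiable_cst.
rewrite (_ : (fun x => _) = cst 0); first exact: IH.
by apply/funext => x; rewrite derive_cst.
Qed.

Lemma CkD k U F G : open U -> Ck k U F -> Ck k U G ->
  Ck k U (fun x => F x + G x).
Proof.
move=> oU; elim: k F G => [|k IH] F G /=.
  by move=> cF cG x Ux; apply: continuousD; [exact: cF|exact: cG].
move=> [dF DF] [dG DG]; split=> [x Ux|v].
  by apply: differentiableD; [exact: dF|exact: dG].
apply: Ck_eq (IH _ _ (DF v) (DG v)) => // x Ux.
by rewrite deriveD//; apply: diff_derivable; [exact: dF|exact: dG].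
Qed.

Lemma CkM k U F G : open U -> Ck k U F -> Ck k U G ->
  Ck k U (fun x => F x * G x).
Proof.
move=> oU; elim: k F G => [|k IH] F G.
  by move=> cF cG x Ux; apply: continuousM; [exact: cF|exact: cG].
(* The Leibniz rule mixes derivatives with the functions themselves, so [F] and [G] are also needed
   at the lower order [k]. *)
move=> CF CG; have [CF' CG'] := (CkW CF, CkW CG).
move: CF CG => [dF DF] [dG DG]; split=> [x Ux|v].
  by apply: differentiableM; [exact: dF|exact: dG].
apply: Ck_eq (CkD oU (IH _ _ CF' (DG v)) (IH _ _ CG' (DF v))) => // x Ux.
by rewrite deriveM//; apply: diff_derivable; [exact: dF|exact: dG].
Qed.

End Ck.

Lemma is_derive_coord (R : realType) n (x v : 'rV[R]_n) a :
  is_derive x v (fun u : 'rV[R]_n => u 0 a) (v 0 a).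
Proof.
have dc : differentiable (fun u : 'rV[R]_n => u 0 a) x.
  exact: differentiable_coord.
apply: DeriveDef; first exact: diff_derivable.
apply: cvg_lim => //; apply: cvg_near_cst.
near=> h; rewrite /= !mxE addrK /GRing.scale /= mulrA mulVf ?mul1r//.
by near: h; exact: nbhs_dnbhs_neq.
Unshelve. all: by end_near. Qed.

Lemma Ck_coord (R : realType) n k (U : set 'rV[R]_n) a :
  Ck k U (fun u : 'rV[R]_n => u 0 a).
Proof.
case: k => [|k]; first by move=> x _; exact: coord_continuous.
split=> [x _|v]; first exact: differentiable_coord.
rewrite (_ : (fun x => _) = cst (v 0 a)); first exact: Ck_cst.
by apply/funext => x; have /@derive_val := is_derive_coord x v a.
Qed.

Section Smooth.
Variable R : realType.
Implicit Types f h : S3 R -> R.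

Lemma smooth_cst (c : R) : smooth (fun _ => c).
Proof.
move=> p; exists setT, (cst c); split=> //; first exact: openT.
by move=> k; exact: Ck_cst.
Qed.

Lemma smooth_coord a : smooth (fun p : S3 R => coords (pt p) 0 a).
Proof.
move=> p; exists setT, (fun u => u 0 a); split=> //; first exact: openT.
by move=> k; exact: Ck_coord.
Qed.

Lemma smoothD f h : smooth f -> smooth h -> smooth (fun p => f p + h p).
Proof.
move=> sf sh p; have [U [F [oU Up CF fF]]] := sf p.
have [U' [G [oU' U'p CG hG]]] := sh p.
exists (U `&` U'), (fun x => F x + G x); split=> //.
- exact: openI.
- move=> k; apply: CkD; first exact: openI.
    exact: Ck_subset (CF k).
  exact: Ck_subset (CG k).
- by move=> q [Uq U'q]; rewrite fF// hG.
Qed.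

Lemma smoothM f h : smooth f -> smooth h -> smooth (fun p => f p * h p).
Proof.
move=> sf sh p; have [U [F [oU Up CF fF]]] := sf p.
have [U' [G [oU' U'p CG hG]]] := sh p.
exists (U `&` U'), (fun x => F x * G x); split=> //.
- exact: openI.
- move=> k; apply: CkM; first exact: openI.
    exact: Ck_subset (CF k).
  exact: Ck_subset (CG k).
- by move=> q [Uq U'q]; rewrite fF// hG.
Qed.

Lemma smoothN f : smooth f -> smooth (fun p => - f p).
Proof.
move=> sf; have := smoothM (smooth_cst (-1)) sf.
by rewrite (_ : (fun p => _) = (fun p => - f p))//; apply/funext => p; rewrite mulN1r.
Qed.

End Smooth.

(** * Symmetry of second derivatives *)

Section Schwarz.
Variables (R : realType) (V : normedModType R).
Implicit Types (U : set V) (F : V -> R).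

(** Turns a directional derivative into a one-variable derivative, to which the mean value theorem
    applies. *)
Lemma is_derive_line F (y u : V) (a : R) : derivable F (y + a *: u) u ->
  is_derive a 1 (fun a : R => F (y + a *: u)) ('D_u F (y + a *: u)).
Proof.
move=> dF; have E : (fun h : R => h^-1 *: (F (y + (h *: 1 + a) *: u) - F (y + a *: u)))
    = (fun h : R => h^-1 *: (F (h *: u + (y + a *: u)) - F (y + a *: u))).
  apply/funext => h; congr (_ *: (F _ - _)).
  by rewrite scalerDl addrCA -[h *: 1]/(h * 1) mulr1.
by apply: DeriveDef; rewrite /derivable /derive /= E.
Qed.

(** The mean value theorem is used twice, first along [u] and then along [v]; each application
    contributes one factor [s]. *)
Lemma second_difference U F (x u v : V) (s : R) : 0 < s -> Ck 2 U F ->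
    (forall a b, 0 <= a <= s -> 0 <= b <= s -> U (x + a *: u + b *: v)) ->
  exists2 ab : R * R, [&& 0 <= ab.1 <= s & 0 <= ab.2 <= s] &
    F (x + s *: u + s *: v) - F (x + s *: u) - (F (x + s *: v) - F x) =
    'D_v (fun y => 'D_u F y) (x + ab.1 *: u + ab.2 *: v) * s ^+ 2.
Proof.
move=> s0 [dF DF] Us.
have s0s : 0 <= (0 : R) <= s by rewrite lexx ltW.
have sss : 0 <= s <= s by rewrite ltW/=.
have itvW (a : R) : a \in `]0, s[%R -> 0 <= a <= s.
  by rewrite in_itv /= => /andP[? ?]; rewrite !ltW.
have itvW' (a : R) : a \in `[0, s]%R -> 0 <= a <= s by rewrite in_itv.
pose f (b a : R) := F (x + b *: v + a *: u).
have df a b : 0 <= a <= s -> 0 <= b <= s ->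
    is_derive a 1 (f b) ('D_u F (x + b *: v + a *: u)).
  move=> ha hb; apply: is_derive_line; apply: diff_derivable; apply: dF.
  by rewrite addrAC; exact: Us.
pose h (a : R) (b : R) := 'D_u F (x + a *: u + b *: v).
have dh a b : 0 <= a <= s -> 0 <= b <= s ->
    is_derive b 1 (h a) ('D_v (fun y => 'D_u F y) (x + a *: u + b *: v)).
  move=> ha hb; apply: is_derive_line; apply: diff_derivable.
  by apply: (DF u).1; exact: Us.
have cont (k : R -> R) : (forall a, 0 <= a <= s -> derivable k a 1) ->
    {within `[0, s], continuous k}.
  by move=> dk; apply: derivable_within_continuous => a /itvW'; exact: dk.
(* First along [u], for the difference between the two sides of the parallelogram parallel to
   [u]. *)
have [a /itvW ha Ea] := @MVT R (f s \- f 0)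
  (fun a => 'D_u F (x + s *: v + a *: u) - 'D_u F (x + 0 *: v + a *: u)) 0 s s0
  (fun a ha => is_deriveB (df a s (itvW a ha) sss) (df a 0 (itvW a ha) s0s))
  (cont _ (fun a ha => derivableB (@ex_derive _ _ _ _ _ _ _ (df a s ha sss))
     (@ex_derive _ _ _ _ _ _ _ (df a 0 ha s0s)))).
(* Then along [v], for the derivative ['D_u F] at the parameter [a] just found. *)
have [b /itvW hb Eb] := @MVT R (h a) _ 0 s s0 (fun b hb => dh a b ha (itvW b hb))
  (cont _ (fun b hb => @ex_derive _ _ _ _ _ _ _ (dh a b ha hb))).
exists (a, b); first by rewrite ha hb.
move: Ea Eb; rewrite /f /h /= !scale0r !addr0 !subr0 [x + _ + a *: u]addrAC => Ea Eb.
rewrite expr2 mulrA -Eb -Ea; rewrite [x + s *: u + _]addrAC; ring.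
Qed.

(* Both mixed derivatives are limits of the same second difference quotient. *)
Lemma derive_comm U F (x u v : V) : open U -> Ck 2 U F -> U x ->
  'D_v (fun y => 'D_u F y) x = 'D_u (fun y => 'D_v F y) x.
Proof.
move=> oU CF Ux.
pose A y := 'D_v (fun y => 'D_u F y) y; pose B y := 'D_u (fun y => 'D_v F y) y.
have cA : A y @[y --> x] --> A x by exact: ((CF.2 u).2 v).
have cB : B y @[y --> x] --> B x by exact: ((CF.2 v).2 u).
apply/eqP; rewrite -subr_eq0 -normr_le0; apply/ler_addgt0Pl => e e0.
have e2 : 0 < e / 2 by rewrite divr_gt0.
move/cvgrPdist_lt: cA => /(_ _ e2) nA; move/cvgrPdist_lt: cB => /(_ _ e2) nB.
have nU : nbhs x U by exact: open_nbhs_nbhs.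
have [r /= r0 rW] := (nbhs_ballP _ _).1 (filterI nU (filterI nA nB)).
(* The side [s] is such that [s * m = r / 2], which keeps the whole parallelogram in the ball of
   radius [r]; the summand 1 makes [m] positive even if [u] and [v] vanish. *)
set m := `|u| + `|v| + 1.
have m0 : 0 < m by rewrite ltr_wpDl// addr_ge0.
pose s := r / m / 2.
have s0 : 0 < s by rewrite !divr_gt0.
have near_x a b : 0 <= a <= s -> 0 <= b <= s -> ball x r (x + a *: u + b *: v).
  move=> /andP[a0 aS] /andP[b0 bS]; rewrite -ball_normE /= -addrA opprD addNKr normrN.
  apply: (@le_lt_trans _ _ (s * m)).
    rewrite (le_trans (ler_normD _ _))// !normrZ (ger0_norm a0) (ger0_norm b0).
    rewrite !mulrDr mulr1 -[leLHS]addr0; apply: lerD; last exact: ltW.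
    by apply: lerD; apply: ler_wpM2r.
  by rewrite /s mulrAC divfK ?gt_eqF// gtr_pMr// invf_lt1// ltr1n.
have [|[a b] /= /andP[ha hb] E1] := @second_difference U F x u v s s0 CF.
  by move=> a b ha hb; have [] := rW _ (near_x a b ha hb).
have [|[a' b'] /= /andP[ha' hb'] E2] := @second_difference U F x v u s s0 CF.
  by move=> a' b' ha' hb'; rewrite addrAC; have [] := rW _ (near_x b' a' hb' ha').
have [_ [Aab _]] := rW _ (near_x a b ha hb).
have [_ [_ Bab]] := rW _ (near_x b' a' hb' ha').
(* The second difference is symmetric in [u] and [v], so the two mixed derivatives agree at two
   possibly different points near [x]. *)
have E : A (x + a *: u + b *: v) = B (x + b' *: u + a' *: v).
  apply: (@mulIf _ (s ^+ 2)); first by rewrite expf_neq0// gt_eqF.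
  rewrite [x + b' *: u + _]addrAC; apply: eq_trans (esym E1) _.
  apply: eq_trans _ E2; rewrite [x + s *: v + _]addrAC !opprB.
  by rewrite addrACA [RHS]addrACA [- F (x + s *: v) - _]addrC.
rewrite addr0; change (`|A x - B x| <= e).
apply: le_trans (ler_distD (A (x + a *: u + b *: v)) _ _) _; rewrite (splitr e).
by apply: lerD; [exact: ltW Aab|rewrite distrC E; exact: ltW Bab].
Qed.

End Schwarz.

(** * Directional derivatives on the sphere *)

Section Euclidean.
Variable R : realType.
Implicit Types (u v w : 'cV[R[i]]_2) (p : S3 R) (a : R).

Lemma gE u v : g u v =
  complex.Re (u 0 0) * complex.Re (v 0 0) + complex.Im (u 0 0) * complex.Im (v 0 0)
  + (complex.Re (u 1 0) * complex.Re (v 1 0)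
     + complex.Im (u 1 0) * complex.Im (v 1 0)).
Proof.
rewrite /g mxE sum2 !mxE.
by case: (u 0 0) (v 0 0) (u 1 0) (v 1 0) => [? ?] [? ?] [? ?] [? ?] /=; ring.
Qed.

Lemma rscaleE a u k : rscale a u k 0 =
  Complex (a * complex.Re (u k 0)) (a * complex.Im (u k 0)).
Proof.
rewrite !mxE; case: (u k 0) => x y.
by apply/eqP; rewrite eq_complex /=; apply/andP; split; apply/eqP; ring.
Qed.

Lemma gDl u v w : g (u + v) w = g u w + g v w.
Proof. by rewrite !gE !mxE !raddfD /=; ring. Qed.

Lemma gC u v : g u v = g v u.
Proof. by rewrite !gE; ring. Qed.

Lemma gDr u v w : g w (u + v) = g w u + g w v.
Proof. by rewrite gC gDl !(gC w). Qed.

Lemma gZl a u w : g (rscale a u) w = a * g u w.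
Proof. by rewrite !gE !rscaleE /=; ring. Qed.

Lemma gZr a u w : g w (rscale a u) = a * g w u.
Proof. by rewrite gC gZl gC. Qed.

Lemma gNl u w : g (- u) w = - g u w.
Proof. by rewrite !gE !mxE !raddfN /=; ring. Qed.

Lemma gNr u w : g w (- u) = - g w u.
Proof. by rewrite gC gNl gC. Qed.

Lemma g0l w : g 0 w = 0.
Proof. by rewrite !gE !mxE /=; ring. Qed.

Lemma g_ge0 u : 0 <= g u u.
Proof. by rewrite gE -!expr2 !addr_ge0// sqr_ge0. Qed.

Lemma coordsD u v : coords (u + v) = coords u + coords v.
Proof.
apply/rowP; case=> [[|[|[|[|//]]]] ?]; rewrite !mxE /tnth /=;
  exact: raddfD.
Qed.

Lemma coordsZ a u : coords (rscale a u) = a *: coords u.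
Proof.
apply/rowP; case=> [[|[|[|[|//]]]] ?];
  by rewrite [LHS]mxE [RHS]mxE [in RHS]mxE /tnth /= rscaleE.
Qed.

End Euclidean.

Section Curve.
Variable R : realType.
Implicit Types (v : 'cV[R[i]]_2) (p : S3 R).

Lemma pt_unit p : g (pt p) (pt p) = 1.
Proof. exact/eqP/(valP p). Qed.

(** By orthogonality [p + t v] has squared norm [1 + t ^+ 2 * g v v], which is positive, so the
    normalised vector lies on the sphere and [insubd] does not fall back on its default. *)
Lemma pt_curve p v t : g (pt p) v = 0 ->
  pt (curve p v t) = rscale (Num.sqrt (1 + t ^+ 2 * g v v))^-1 (pt p + rscale t v).
Proof.
move=> pv; rewrite /pt /curve -/(pt p).
have ww : g (pt p + rscale t v) (pt p + rscale t v) = 1 + t ^+ 2 * g v v.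
  by rewrite !(gDl, gDr, gZl, gZr) (gC v) pv pt_unit; ring.
have w0 : 0 < 1 + t ^+ 2 * g v v by rewrite ltr_wpDr// mulr_ge0 ?sqr_ge0 ?g_ge0.
rewrite ww val_insubd; case: ifPn => // /eqP[].
rewrite gZl gZr ww mulrA -invfM -expr2 sqr_sqrtr ?ltW// mulVf//.
by rewrite gt_eqF.
Qed.

Lemma curve0 p v : g (pt p) v = 0 -> curve p v 0 = p.
Proof.
move=> pv; apply: val_inj; rewrite -[LHS]/(pt _) pt_curve// expr0n mul0r addr0.
by rewrite sqrtr1 invr1 /rscale rmorph1 scale1r rmorph0 scale0r addr0.
Qed.

(** The normalising factor [n] depends on [t] through [t ^+ 2] alone, so its derivative at 0
    vanishes and only [v] remains. *)
Lemma is_derive_coords_curve p v : g (pt p) v = 0 ->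
  is_derive (0 : R) 1 (fun t => coords (pt (curve p v t))) (coords v).
Proof.
move=> pv; set c := g v v.
pose n (t : R) := (Num.sqrt (1 + t ^+ 2 * c))^-1.
have dn : is_derive (0 : R) 1 n 0.
  have dq : is_derive (0 : R) 1 (fun t : R => 1 + t ^+ 2 * c) 0.
    have h := is_deriveD (@is_derive_cst R R R 1 0 1)
      (is_deriveM (is_deriveX 2 (@is_derive_id R R 0 1)) (@is_derive_cst R R R c 0 1)).
    by apply: is_derive_eq h _; rewrite /= /GRing.scale /=; ring.
  have ds : is_derive (0 : R) 1 (Num.sqrt \o (fun t : R => 1 + t ^+ 2 * c)) 0.
    rewrite -[X in is_derive _ _ _ X](mulr0 (2 * Num.sqrt 1)^-1).
    apply: is_derive1_comp; rewrite /= expr0n mul0r addr0; exact: is_derive1_sqrt.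
  have s0 : (Num.sqrt \o (fun t : R => 1 + t ^+ 2 * c)) 0 != 0.
    by rewrite /= expr0n mul0r addr0 sqrtr1 oner_neq0.
  apply: DeriveDef; first by apply: derivableV.
  by rewrite deriveV// derive_val scaler0.
have E : (fun t => coords (pt (curve p v t))) =
    (fun t => n t *: (coords (pt p) + t *: coords v)).
  by apply/funext => t; rewrite pt_curve// coordsZ coordsD coordsZ.
rewrite E.
have dc k : is_derive (0 : R) 1
    (fun t => (n t *: (coords (pt p) + t *: coords v)) 0 k) (coords v 0 k).
  have dk := is_deriveM dn (is_deriveD (@is_derive_cst R R R (coords (pt p) 0 k) 0 1)
    (is_deriveM (@is_derive_id R R 0 1) (@is_derive_cst R R R (coords v 0 k) 0 1))).
  apply: near_eq_is_derive (is_derive_eq dk _); first by near=> t; rewrite !mxE.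
  rewrite /= /GRing.scale /= /n expr0n mul0r addr0 sqrtr1 invr1; ring.
have dE : derivable (fun t : R => n t *: (coords (pt p) + t *: coords v)) 0 1.
  apply/derivable_mxP => k l; rewrite ord1.
  exact: (@ex_derive _ _ _ _ _ _ _ (dc l)).
apply: DeriveDef => //; rewrite derive_mx//; apply/rowP => k; rewrite mxE.
exact: (@derive_val _ _ _ _ _ _ _ (dc k)).
Unshelve. all: by end_near. Qed.

(** The chain rule for the local extension [F]: by continuity the curve stays in [U] for small [t],
    where [f] is given by [F]. *)
Lemma is_derive_curve (f : S3 R -> R) p v (U : set 'rV[R]_4) F :
  g (pt p) v = 0 -> open U -> U (coords (pt p)) ->
  differentiable F (coords (pt p)) ->
  (forall q, U (coords (pt q)) -> f q = F (coords (pt q))) ->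
  is_derive (0 : R) 1 (fun t => f (curve p v t)) ('D_(coords v) F (coords (pt p))).
Proof.
move=> pv oU Up dF fF; have dc := is_derive_coords_curve pv.
have dg : differentiable (fun t : R => coords (pt (curve p v t))) 0.
  exact/derivable1_diffP/(@ex_derive _ _ _ _ _ _ _ dc).
have dF' : differentiable F (coords (pt (curve p v 0))) by rewrite curve0.
have h : is_derive (0 : R) 1 (F \o (fun t : R => coords (pt (curve p v t))))
    ('D_(coords v) F (coords (pt p))).
  have dFg : differentiable (F \o (fun t : R => coords (pt (curve p v t)))) 0.
    exact: differentiable_comp.
  apply: DeriveDef; first exact: diff_derivable.
  rewrite deriveE// diff_comp//= -[X in 'd F _ X]deriveE//.
  rewrite -deriveE// curve0//; congr ('D_ _ _ _).
  exact: (@derive_val _ _ _ _ _ _ _ dc).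
apply: near_eq_is_derive h; near=> t; apply/esym/fF.
near: t; apply: (differentiable_continuous dg).
by apply: open_nbhs_nbhs; split=> //; rewrite curve0.
Unshelve. all: by end_near. Qed.

End Curve.

(** * Vector fields as derivations and their commutators *)

Lemma derive_delta (R : realType) n (F : 'rV[R]_n -> R) x v :
  differentiable F x ->
  'D_v F x = \sum_(a < n) v 0 a * 'D_(delta_mx 0 a) F x.
Proof.
move=> dF; rewrite deriveE// [in LHS](row_sum_delta v) linear_sum.
by apply: eq_bigr => a _; rewrite linearZ /= -deriveE.
Qed.

Section Derivation.
Variable R : realType.
Implicit Types (f h : S3 R -> R) (X Y : field R) (p : S3 R).

(** Since [derive1] is total, [dirder] alone does not assert differentiability; this supplies it, so
    that the rules for sums and products become available. *)
Lemma is_derive_dirder f p v : smooth f -> g (pt p) v = 0 ->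
  is_derive (0 : R) 1 (fun t => f (curve p v t)) (dirder f p v).
Proof.
move=> sf pv; have [U [F [oU Up CF fF]]] := sf p.
have h := is_derive_curve pv oU Up ((CF 1).1 _ Up) fF.
by rewrite /dirder derive1E; apply: derivableP; exact: (@ex_derive _ _ _ _ _ _ _ h).
Qed.

Lemma dirderE f p v (U : set 'rV[R]_4) F : g (pt p) v = 0 -> open U ->
  U (coords (pt p)) -> differentiable F (coords (pt p)) ->
  (forall q, U (coords (pt q)) -> f q = F (coords (pt q))) ->
  dirder f p v = 'D_(coords v) F (coords (pt p)).
Proof.
move=> pv oU Up dF fF; rewrite /dirder derive1E.
exact: (@derive_val _ _ _ _ _ _ _ (is_derive_curve pv oU Up dF fF)).
Qed.

Lemma dirder_coord p v a : g (pt p) v = 0 ->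
  dirder (fun q => coords (pt q) 0 a) p v = coords v 0 a.
Proof.
move=> pv; rewrite (@dirderE _ _ _ setT (fun u => u 0 a))//.
- exact: (@derive_val _ _ _ _ _ _ _ (is_derive_coord (coords (pt p)) (coords v) a)).
- exact: openT.
- exact: differentiable_coord.
Qed.

Lemma vf_coord X a : vf X -> smooth (fun p => coords (X p) 0 a).
Proof.
move=> [_ sX]; rewrite [X in smooth X](_ : _ = (fun p =>
  tnth [tuple complex.Re (X p 0 0); complex.Im (X p 0 0);
              complex.Re (X p 1 0); complex.Im (X p 1 0)] a)).
  case: a => [[|[|[|[|//]]]] ?];
    [exact: (sX 0).1|exact: (sX 0).2|exact: (sX 1).1|exact: (sX 1).2].
by apply/funext => p; rewrite mxE.
Qed.

Lemma coords_actf X Y p a :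
  coords (actf X Y p) 0 a = act X (fun q => coords (Y q) 0 a) p.
Proof.
rewrite mxE (_ : (fun q => coords (Y q) 0 a) = (fun p =>
  tnth [tuple complex.Re (Y p 0 0); complex.Im (Y p 0 0);
              complex.Re (Y p 1 0); complex.Im (Y p 1 0)] a)).
  by case: a => [[|[|[|[|//]]]] ?]; rewrite /tnth /= !mxE.
by apply/funext => q; rewrite mxE.
Qed.

(** Near [p], [Y f] is the sum of the components of [Y] times the partial derivatives of [F].
    Differentiating along [X] gives a first-order term, where the components of [Y] are
    differentiated, and the Hessian of [F] on the two fields. *)
Lemma act_act f X Y p (U : set 'rV[R]_4) F : vf X -> vf Y ->
  open U -> U (coords (pt p)) -> Ck 2 U F ->
  (forall q, U (coords (pt q)) -> f q = F (coords (pt q))) ->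
  act X (act Y f) p =
    'D_(coords (actf X Y p)) F (coords (pt p)) +
    'D_(coords (Y p)) (fun y => 'D_(coords (X p)) F y) (coords (pt p)).
Proof.
move=> vX vY oU Up CF fF; have pX := vX.1 p.
have [dF DF] := CF.
pose D a y := 'D_(delta_mx 0 a) F y.
have YfE q : U (coords (pt q)) ->
    act Y f q = \sum_a coords (Y q) 0 a * D a (coords (pt q)).
  move=> Uq; rewrite /act (dirderE (vY.1 q) oU Uq (dF _ Uq) fF) derive_delta//.
  exact: dF.
have dYa a := is_derive_dirder (vf_coord a vY) pX.
have dD a := is_derive_curve pX oU Up ((DF (delta_mx 0 a)).1 _ Up)
  (f := fun q => D a (coords (pt q))) (fun q _ => erefl).
have h := is_derive_sum (fun a => is_deriveM (dYa a) (dD a)).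
have nU : \forall t \near (0 : R), U (coords (pt (curve p (X p) t))).
  have dc := is_derive_coords_curve pX.
  have /derivable1_diffP/differentiable_continuous := @ex_derive _ _ _ _ _ _ _ dc.
  apply.
  by apply: open_nbhs_nbhs; split=> //; rewrite curve0.
rewrite {1}/act /dirder derive1E.
transitivity ('D_1 (\sum_a
    ((fun t => coords (Y (curve p (X p) t)) 0 a) *
     (fun t => D a (coords (pt (curve p (X p) t))))) : R -> R) (0 : R)).
  apply: near_eq_derive; apply: filterS nU => t Ut.
  by rewrite YfE// fct_sumE.
rewrite (@derive_val _ _ _ _ _ _ _ h) big_split /= addrC; congr (_ + _).
  rewrite [RHS]derive_delta; last exact: dF.
  by apply: eq_bigr => a _; rewrite (curve0 pX) coords_actf [LHS]mulrC.
rewrite [RHS]derive_delta; last exact: (DF _).1.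
apply: eq_bigr => a _; rewrite (curve0 pX).
apply: (congr1 (fun r => coords (Y p) 0 a * r)).
(* Puts the Hessian in the form where the inner derivative is along the fixed vector [X p]. *)
exact: derive_comm oU CF Up.
Qed.

(** The two Hessian terms cancel by symmetry, and the first-order terms combine into the derivative
    along the bracket. Tangency of the bracket is what lets [dirder] be computed from [F]; it is
    proved later, in [vf_bracket]. *)
Lemma act_bracket f X Y p : smooth f -> vf X -> vf Y ->
  g (pt p) (bracket X Y p) = 0 ->
  act (bracket X Y) f p = act X (act Y f) p - act Y (act X f) p.
Proof.
move=> sf vX vY pB; have [U [F [oU Up CF fF]]] := sf p.
have dF : differentiable F (coords (pt p)) by exact: (CF 1).1.
rewrite (act_act vX vY oU Up (CF 2) fF) (act_act vY vX oU Up (CF 2) fF).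
rewrite /act (dirderE pB oU Up dF fF).
have subr_same (a b c d : R) : c = d -> a + c - (b + d) = a - b.
  by move=> ->; rewrite opprD addrACA subrr addr0.
apply: eq_trans _ (esym (subr_same _ _ _ _
  (derive_comm (coords (X p)) (coords (Y p)) oU (CF 2) Up))).
rewrite !deriveE// -linearB /=; congr ('d _ _ _).
have -> : bracket X Y p = actf X Y p + rscale (-1) (actf Y X p).
  by rewrite /bracket /fsub /rscale rmorphN rmorph1 scaleN1r.
by rewrite coordsD coordsZ scaleN1r.
Qed.

End Derivation.

(** * The left-invariant frame *)

Definition i0 : 'I_3 := Ordinal (isT : (0 < 3)%N).
Definition i1 : 'I_3 := Ordinal (isT : (1 < 3)%N).
Definition i2 : 'I_3 := Ordinal (isT : (2 < 3)%N).

Lemma ord3_ind (P : 'I_3 -> Prop) : P i0 -> P i1 -> P i2 -> forall i, P i.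
Proof.
move=> P0 P1 P2; case=> [[|[|[|//]]] iP].
- by rewrite (_ : Ordinal iP = i0)//; exact: val_inj.
- by rewrite (_ : Ordinal iP = i1)//; exact: val_inj.
- by rewrite (_ : Ordinal iP = i2)//; exact: val_inj.
Qed.

Lemma sum3 (V : nmodType) (F : 'I_3 -> V) : \sum_k F k = F i0 + F i1 + F i2.
Proof.
rewrite !big_ord_recl big_ord0 addr0 addrA.
by congr (F _ + F _ + F _); exact: val_inj.
Qed.

Lemma ord2_ind (P : 'I_2 -> Prop) : P 0 -> P 1 -> forall i, P i.
Proof.
move=> P0 P1; case=> [[|[|//]] iP].
- by rewrite (_ : Ordinal iP = 0)//; exact: val_inj.
- by rewrite (_ : Ordinal iP = 1)//; exact: val_inj.
Qed.

Section Derivations.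
Variable R : realType.
Implicit Types (f h : S3 R -> R) (p : S3 R).

Lemma dirder_cst (c : R) p v : dirder (fun _ => c) p v = 0.
Proof. by rewrite /dirder derive1E derive_cst. Qed.

Lemma dirderD f h p v : smooth f -> smooth h -> g (pt p) v = 0 ->
  dirder (fun q => f q + h q) p v = dirder f p v + dirder h p v.
Proof.
move=> sf sh pv; rewrite {1}/dirder derive1E.
exact: (@derive_val _ _ _ _ _ _ _
  (is_deriveD (is_derive_dirder sf pv) (is_derive_dirder sh pv))).
Qed.

Lemma dirderM f h p v : smooth f -> smooth h -> g (pt p) v = 0 ->
  dirder (fun q => f q * h q) p v = f p * dirder h p v + h p * dirder f p v.
Proof.
move=> sf sh pv; rewrite {1}/dirder derive1E.
rewrite [LHS](@derive_val _ _ _ _ _ _ _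
  (is_deriveM (is_derive_dirder sf pv) (is_derive_dirder sh pv))).
by rewrite (curve0 pv).
Qed.

Lemma dirderN f p v : smooth f -> g (pt p) v = 0 ->
  dirder (fun q => - f q) p v = - dirder f p v.
Proof.
move=> sf pv; rewrite {1}/dirder derive1E.
exact: (@derive_val _ _ _ _ _ _ _ (is_deriveN (is_derive_dirder sf pv))).
Qed.

Lemma dirderB f h p v : smooth f -> smooth h -> g (pt p) v = 0 ->
  dirder (fun q => f q - h q) p v = dirder f p v - dirder h p v.
Proof. by move=> sf sh pv; rewrite dirderD ?dirderN//; exact: smoothN. Qed.

Lemma smoothB f h : smooth f -> smooth h -> smooth (fun p => f p - h p).
Proof. by move=> sf sh; apply: smoothD => //; exact: smoothN. Qed.

Lemma coords0 (u : 'cV[R[i]]_2) : coords u 0 0 = complex.Re (u 0 0).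
Proof. by rewrite mxE. Qed.
Lemma coords1 (u : 'cV[R[i]]_2) : coords u 0 1 = complex.Im (u 0 0).
Proof. by rewrite mxE. Qed.
Lemma coords2 (u : 'cV[R[i]]_2) : coords u 0 2 = complex.Re (u 1 0).
Proof. by rewrite mxE. Qed.
Lemma coords3 (u : 'cV[R[i]]_2) : coords u 0 3 = complex.Im (u 1 0).
Proof. by rewrite mxE. Qed.

Lemma smooth_Re k : smooth (fun p : S3 R => complex.Re (pt p k 0)).
Proof.
elim/ord2_ind: k.
  under eq_fun do rewrite -coords0; exact: smooth_coord.
under eq_fun do rewrite -coords2; exact: smooth_coord.
Qed.

Lemma smooth_Im k : smooth (fun p : S3 R => complex.Im (pt p k 0)).
Proof.
elim/ord2_ind: k.
  under eq_fun do rewrite -coords1; exact: smooth_coord.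
under eq_fun do rewrite -coords3; exact: smooth_coord.
Qed.

Lemma dirder_Re p v k : g (pt p) v = 0 ->
  dirder (fun q => complex.Re (pt q k 0)) p v = complex.Re (v k 0).
Proof.
move=> pv; elim/ord2_ind: k.
  by under eq_fun do rewrite -coords0; rewrite dirder_coord// coords0.
by under eq_fun do rewrite -coords2; rewrite dirder_coord// coords2.
Qed.

Lemma dirder_Im p v k : g (pt p) v = 0 ->
  dirder (fun q => complex.Im (pt q k 0)) p v = complex.Im (v k 0).
Proof.
move=> pv; elim/ord2_ind: k.
  by under eq_fun do rewrite -coords1; rewrite dirder_coord// coords1.
by under eq_fun do rewrite -coords3; rewrite dirder_coord// coords3.
Qed.

End Derivations.

Section Frame.
Variable R : realType.
Implicit Types (u v : 'cV[R[i]]_2) (X Y Z : field R) (p q : S3 R) (f : S3 R -> R).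

(** The frame fields are restrictions of real-linear maps of C^2, recorded here. Differentiating
    such a field amounts to applying the same map to the direction, see [actf_E]. *)
Definition Elin (k : 'I_3) u : 'cV[R[i]]_2 :=
  tnth [tuple col2 (Num.conj (u 1 0)) (- Num.conj (u 0 0));
              imul (col2 (Num.conj (u 1 0)) (- Num.conj (u 0 0))); imul u] k.

Lemma E_lin k p : E k p = Elin k (pt p).
Proof.
elim/ord3_ind: k; apply/matrixP => k l; rewrite !ord1; elim/ord2_ind: k;
  rewrite /E /Elin /tnth /= /E1 /E2 /E3 /left_field !mxE !sum2 !mxE !sum2 !mxE /=;
  ring.
Qed.

Lemma Elin_Re0 k u : complex.Re (Elin k u 0 0) =
  tnth [tuple complex.Re (u 1 0); complex.Im (u 1 0); - complex.Im (u 0 0)] k.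
Proof.
by elim/ord3_ind: k; rewrite /Elin /tnth /= !mxE /=;
  case: (u 0 0) (u 1 0) => [a b] [c d] /=; ring.
Qed.

Lemma Elin_Im0 k u : complex.Im (Elin k u 0 0) =
  tnth [tuple - complex.Im (u 1 0); complex.Re (u 1 0); complex.Re (u 0 0)] k.
Proof.
by elim/ord3_ind: k; rewrite /Elin /tnth /= !mxE /=;
  case: (u 0 0) (u 1 0) => [a b] [c d] /=; ring.
Qed.

Lemma Elin_Re1 k u : complex.Re (Elin k u 1 0) =
  tnth [tuple - complex.Re (u 0 0); - complex.Im (u 0 0); - complex.Im (u 1 0)] k.
Proof.
by elim/ord3_ind: k; rewrite /Elin /tnth /= !mxE /=;
  case: (u 0 0) (u 1 0) => [a b] [c d] /=; ring.
Qed.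

Lemma Elin_Im1 k u : complex.Im (Elin k u 1 0) =
  tnth [tuple complex.Im (u 0 0); - complex.Re (u 0 0); complex.Re (u 1 0)] k.
Proof.
by elim/ord3_ind: k; rewrite /Elin /tnth /= !mxE /=;
  case: (u 0 0) (u 1 0) => [a b] [c d] /=; ring.
Qed.

Definition ElinE := (Elin_Re0, Elin_Im0, Elin_Re1, Elin_Im1).

Lemma gEE j k p : g (E j p) (E k p) = (j == k)%:R.
Proof.
have := pt_unit p; rewrite !E_lin !gE !ElinE => h.
by elim/ord3_ind: j; elim/ord3_ind: k; rewrite /tnth /= ?mulr1n ?mulr0n -?h; ring.
Qed.

Lemma gpE k p : g (pt p) (E k p) = 0.
Proof.
rewrite !E_lin !gE !ElinE.
by elim/ord3_ind: k; rewrite /tnth /=; ring.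
Qed.

(** The point [p] and the three vectors [E k p] form an orthonormal basis of R^4. *)
Lemma g_parseval p u v :
  g u v = g (pt p) u * g (pt p) v + \sum_k g (E k p) u * g (E k p) v.
Proof.
(* Multiplying the left side by the squared norm of [p] makes this a polynomial identity valid for
   every vector [p]. *)
have := pt_unit p; rewrite sum3 !E_lin => h; rewrite -[LHS]mul1r -{1}h; clear h.
rewrite !gE !ElinE /tnth /=; ring.
Qed.

Lemma g_eq0 u : g u u = 0 -> u = 0.
Proof.
rewrite gE -!expr2 => /eqP; rewrite !paddr_eq0 ?addr_ge0 ?sqr_ge0// !sqrf_eq0.
move=> /andP[/andP[/eqP a /eqP b] /andP[/eqP c /eqP d]].
apply/matrixP => k l; rewrite ord1 mxE; apply/eqP; rewrite eq_complex /=.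
by elim/ord2_ind: k; rewrite ?a ?b ?c ?d !eqxx.
Qed.

Lemma tangent_eq p u v : g (pt p) u = 0 -> g (pt p) v = 0 ->
  (forall k, g (E k p) u = g (E k p) v) -> u = v.
Proof.
move=> pu pv Euv; apply/eqP; rewrite -subr_eq0; apply/eqP/g_eq0.
rewrite (g_parseval p) gDr gNr pu pv subr0 mulr0 add0r big1// => k _.
by rewrite gDr gNr Euv subrr mul0r.
Qed.

Lemma g_tangent p u v : g (pt p) u = 0 ->
  g u v = \sum_k g (E k p) u * g (E k p) v.
Proof. by move=> pu; rewrite (g_parseval p) pu mul0r add0r. Qed.

Lemma g_sumr I (r : seq I) (P : pred I) (F : I -> 'cV[R[i]]_2) w :
  g w (\sum_(k <- r | P k) F k) = \sum_(k <- r | P k) g w (F k).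
Proof.
by elim/big_rec2: _ => [|k x y _ <-]; rewrite ?gDr// gC g0l.
Qed.

Lemma smooth_gf X Y : vf X -> vf Y -> smooth (gf X Y).
Proof.
move=> [_ sX] [_ sY]; rewrite (_ : gf X Y = (fun p =>
    complex.Re (X p 0 0) * complex.Re (Y p 0 0)
    + complex.Im (X p 0 0) * complex.Im (Y p 0 0)
    + (complex.Re (X p 1 0) * complex.Re (Y p 1 0)
       + complex.Im (X p 1 0) * complex.Im (Y p 1 0)))).
  have := (sX 0, sX 1, sY 0, sY 1) => -[[[[? ?] [? ?]] [? ?]] [? ?]].
  by apply: smoothD; apply: smoothD; apply: smoothM.
by apply/funext => p; rewrite /gf gE.
Qed.

Lemma vf_E k : vf (E k : field R).
Proof.
split=> [p|l]; first exact: gpE.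
have Es : E k = (fun p : S3 R => Elin k (pt p)).
  by apply/funext => p; exact: E_lin.
rewrite Es; elim/ord2_ind: l; split; under eq_fun do rewrite ElinE;
  elim/ord3_ind: k {Es}; rewrite /tnth /=;
  do ?[exact: smooth_Re | exact: smooth_Im | apply: smoothN].
Qed.

Lemma vf_fadd X Y : vf X -> vf Y -> vf (fadd X Y).
Proof.
move=> [tX sX] [tY sY]; split=> [p|k]; first by rewrite /fadd gDr tX tY addr0.
have [? ?] := sX k; have [? ?] := sY k; rewrite /fadd.
split; under eq_fun do rewrite mxE raddfD; exact: smoothD.
Qed.

Lemma vf_fscale f X : smooth f -> vf X -> vf (fscale f X).
Proof.
move=> sf [tX sX]; split=> [p|k]; first by rewrite /fscale gZr tX mulr0.
have [? ?] := sX k; rewrite /fscale.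
by split; under eq_fun do rewrite rscaleE /=; exact: smoothM.
Qed.

Lemma fsubE X Y : fsub X Y = fadd X (fscale (fun _ => -1) Y).
Proof.
by apply/funext => p; rewrite /fsub /fadd /fscale /rscale rmorphN rmorph1 scaleN1r.
Qed.

Lemma vf_fsub X Y : vf X -> vf Y -> vf (fsub X Y).
Proof.
move=> vX vY; rewrite fsubE; apply: vf_fadd => //; apply: vf_fscale => //.
exact: smooth_cst.
Qed.

End Frame.

(** * The cross product and the Levi-Civita symbol *)

Section Cross.
Variable R : comRingType.
Implicit Types x y z : 'I_3 -> R.

Definition cross x y (k : 'I_3) : R :=
  tnth [tuple x i1 * y i2 - x i2 * y i1; x i2 * y i0 - x i0 * y i2;
              x i0 * y i1 - x i1 * y i0] k.

Definition kron (i j : 'I_3) : R := (i == j)%:R.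
(** The Levi-Civita symbol, as the structure constants of the cross product. *)
Definition eps (i j k : 'I_3) : R := cross (kron i) (kron j) k.

Lemma sum_eps x y k : \sum_i \sum_j x i * y j * eps i j k = cross x y k.
Proof.
rewrite !sum3 /eps /cross /kron.
by elim/ord3_ind: k; rewrite /tnth /=; ring.
Qed.

Lemma epsC i j k : eps i j k = - eps j i k.
Proof.
by elim/ord3_ind: i; elim/ord3_ind: j; elim/ord3_ind: k;
   rewrite /eps /cross /kron /tnth /=; ring.
Qed.

Lemma eps_cyc i j k : eps i j k = eps j k i.
Proof.
by elim/ord3_ind: i; elim/ord3_ind: j; elim/ord3_ind: k;
   rewrite /eps /cross /kron /tnth /=; ring.
Qed.

End Cross.

(** * Brackets of the frame fields *)

Section Bracket.
Variable R : realType.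
Implicit Types (u v : 'cV[R[i]]_2) (X Y Z : field R) (p q : S3 R).

Lemma actf_E X k p : vf X -> actf X (E k) p = Elin k (X p).
Proof.
move=> vX; have pX := vX.1 p; have Es : E k = (fun p : S3 R => Elin k (pt p)).
  by apply/funext => q; exact: E_lin.
have eq_dirder (f h : S3 R -> R) : f =1 h -> act X f p = act X h p.
  by move=> fh; congr (act X _ p); apply/funext.
apply/matrixP => l m; rewrite ord1 mxE; apply/eqP.
rewrite eq_complex /=; apply/andP; split; apply/eqP; rewrite Es;
  elim/ord2_ind: l;
  rewrite [RHS]ElinE;
  (rewrite (eq_dirder _ _ (fun q => Elin_Re0 k (pt q)))
   || rewrite (eq_dirder _ _ (fun q => Elin_Im0 k (pt q)))
   || rewrite (eq_dirder _ _ (fun q => Elin_Re1 k (pt q)))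
   || rewrite (eq_dirder _ _ (fun q => Elin_Im1 k (pt q))));
  elim/ord3_ind: k {Es}; rewrite /tnth /= /act ?dirderN ?dirder_Re ?dirder_Im//;
  solve [exact: smooth_Re | exact: smooth_Im].
Qed.

(** By linearity of the frame fields the bracket is [Elin j (E i p) - Elin i (E j p)], and the value
    follows from the unit norm of [p]. *)
Lemma bracket_E i j k p : flat (E k) (bracket (E i) (E j)) p = -2 * eps R i j k.
Proof.
rewrite /flat /gf /bracket /fsub !actf_E; try exact: vf_E.
rewrite gDr gNr !E_lin !gE; have := pt_unit p; rewrite gE !ElinE.
move: (complex.Re (pt p 0 0)) (complex.Im (pt p 0 0)) (complex.Re (pt p 1 0))
    (complex.Im (pt p 1 0)) => a b c d h.
by elim/ord3_ind: i; elim/ord3_ind: j; elim/ord3_ind: k;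
   rewrite /eps /cross /kron /tnth /=; lra.
Qed.

End Bracket.

(** * Connections in an orthonormal frame with the brackets of su(2) *)

Section CrossTheory.
Variable R : realFieldType.
Implicit Types (x y z a : 'I_3 -> R) (H : 'I_3 -> 'I_3 -> 'I_3 -> R).

Lemma sum_kron a k : \sum_j a j * kron R k j = a k.
Proof. by rewrite sum3 /kron; elim/ord3_ind: k => /=; ring. Qed.

(** For each [i] the skew 3 by 3 matrix [H i] is the cross product with a vector, whose entries are
    the three independent entries of the matrix. *)
Lemma skew23E H : (forall i j k, H i j k = - H i k j) ->
  exists t : 'I_3 -> 'I_3 -> R, forall i j k,
    H i j k = \sum_l t i l * eps R l j k.
Proof.
move=> s; exists (fun i l => tnth [tuple H i i1 i2; H i i2 i0; H i i0 i1] l).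
move=> i j k; rewrite sum3 /eps /cross /kron.
have := (s i i0 i1, s i i1 i2, s i i2 i0) => -[[h1 h2] h3]; have h4 := s i j k.
by elim/ord3_ind: j h4; elim/ord3_ind: k; rewrite /tnth /= => h4; lra.
Qed.

(** Alternating trilinear forms in dimension 3 are multiples of the determinant. *)
Lemma skew3E H : (forall i j k, H i j k = - H i k j) ->
  (forall i j k, H i j k = - H k j i) ->
  forall i j k, H i j k = H i0 i1 i2 * eps R i j k.
Proof.
move=> s t i j k; rewrite /eps /cross /kron.
have := (s i0 i1 i2, s i1 i2 i0, s i2 i0 i1) => -[[h1 h2] h3].
have := (t i0 i1 i2, t i1 i2 i0, t i2 i0 i1) => -[[k1 k2] k3].
have := (s i j k, t i j k, s j i k) => -[[l1 l2] l3]; have l4 := t i k j.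
by elim/ord3_ind: i l1 l2 l3 l4; elim/ord3_ind: j; elim/ord3_ind: k;
  rewrite /tnth /= => l1 l2 l3 l4; lra.
Qed.

(** The uniqueness argument for the Levi-Civita connection: applying the two symmetries alternately,
    six times in all, returns to [H i j k] with the opposite sign. *)
Lemma koszul H : (forall i j k, H i j k = - H i k j) ->
  (forall i j k, H i j k = H j i k) -> forall i j k, H i j k = 0.
Proof.
move=> s t i j k.
have := (s i j k, t i k j, s k i j, t k j i, s j k i, t j i k).
by move=> -[[[[[]]]]]; lra.
Qed.

Lemma crossC x y k : cross x y k = - cross y x k.
Proof. by rewrite /cross; elim/ord3_ind: k; rewrite /tnth /=; ring. Qed.

Lemma crossDr c x y z k :
  cross x (fun i => y i + c * z i) k = cross x y k + c * cross x z k.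
Proof. by rewrite /cross; elim/ord3_ind: k; rewrite /tnth /=; ring. Qed.

(** Here [A] and [B] stand for the second derivatives X(Y(z)) and Y(X(z)) of a component of the
    third field, [Xy] for the derivatives of the components of Y along X, and so on. All derivatives
    cancel; the [c ^+ 2] terms combine by the Jacobi identity, and the bracket contributes
    [2 * c]. *)
Lemma curvature_algebra c x y z Xy Yx Xz Yz (A B : R) k :
  A + c * (cross Xy z k + cross y Xz k) + c * (cross x Yz k + c * cross x (cross y z) k)
  - (B + c * (cross Yx z k + cross x Yz k)
     + c * (cross y Xz k + c * cross y (cross x z) k))
  - (A - B + c * cross (fun i => Xy i - Yx i - 2 * cross x y i) z k) =
  (c ^+ 2 + 2 * c) * cross (cross x y) z k.
Proof. by rewrite /cross; elim/ord3_ind: k; rewrite /tnth /=; ring. Qed.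

(** By the double product formula the k-th summand, up to [c], is [y k * z k] minus the inner
    product of [y] and [z]; summing gives 1 - 3 = -2 times that product. *)
Lemma trace_cross c y z :
  \sum_k c * cross (cross (kron R k) y) z k = - 2 * c * \sum_k y k * z k.
Proof. by rewrite !sum3 /cross /kron /tnth /=; ring. Qed.

Lemma tensor_cross (t : 'I_3 -> 'I_3 -> R) x y k :
  \sum_i \sum_j x i * y j * (\sum_l t i l * eps R l j k) =
  cross (fun l => \sum_i t i l * x i) y k.
Proof.
by rewrite !sum3 /eps /cross /kron; elim/ord3_ind: k; rewrite /tnth /= !sum3; ring.
Qed.

Lemma sum_cross_kron (t : 'I_3 -> 'I_3 -> R) x y k :
  \sum_i \sum_j t i j * x i * cross (kron R j) y k =
  cross (fun l => \sum_i t i l * x i) y k.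
Proof.
by rewrite !sum3 /cross /kron; elim/ord3_ind: k; rewrite /tnth /= !sum3; ring.
Qed.

(** The map [cross a] is skew for the inner product, so adding it to the derivatives leaves the
    right side of the metric condition unchanged. *)
Lemma eq_sum_cross a y z u v u' v' :
  (forall k, u' k = u k + cross a y k) -> (forall k, v' k = v k + cross a z k) ->
  \sum_k u k * z k + \sum_k y k * v k = \sum_k u' k * z k + \sum_k y k * v' k.
Proof.
by move=> hu hv; rewrite !sum3 !hu !hv /cross /tnth /=; ring.
Qed.

Definition triple x y z : R := \sum_k cross x y k * z k.

Lemma triple_linear (a : R) x x' y z : [/\
  triple (fun k => a * x k + x' k) y z = a * triple x y z + triple x' y z,
  triple y (fun k => a * x k + x' k) z = a * triple y x z + triple y x' z &
  triple y z (fun k => a * x k + x' k) = a * triple y z x + triple y z x'].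
Proof. by split; rewrite /triple !sum3 /cross /tnth /=; ring. Qed.

Lemma triple_alt x y : [/\ triple x x y = 0, triple x y y = 0 & triple x y x = 0].
Proof. by split; rewrite /triple sum3 /cross /tnth /=; ring. Qed.

End CrossTheory.

Section Combination.
Variable R : realType.
Implicit Types (f : 'I_3 -> S3 R -> R) (Y : 'I_3 -> field R) (X : field R).

Definition comb f Y : field R := fun p => \sum_k rscale (f k p) (Y k p).

Lemma combE f Y : comb f Y = fadd (fadd (fscale (f i0) (Y i0))
  (fscale (f i1) (Y i1))) (fscale (f i2) (Y i2)).
Proof. by apply/funext => p; rewrite /comb sum3. Qed.

Variables (nabla : conn R) (hn : affine_connection nabla).

Lemma conn_combl f Y X : (forall k, smooth (f k)) -> (forall k, vf (Y k)) ->
  vf X -> nabla (comb f Y) X = comb f (fun k => nabla (Y k) X).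
Proof.
move=> sf vY vX; have [_ nD nZ _ _] := hn; rewrite !combE.
by rewrite !nD ?nZ//; do ?apply: vf_fadd; exact: vf_fscale.
Qed.

Lemma conn_combr f Y X p : (forall k, smooth (f k)) -> (forall k, vf (Y k)) ->
  vf X -> nabla X (comb f Y) p =
    \sum_k (rscale (act X (f k) p) (Y k p) + rscale (f k p) (nabla X (Y k) p)).
Proof.
move=> sf vY vX; have [_ _ _ nD nZ] := hn; rewrite !combE sum3.
by rewrite !nD ?nZ//; do ?apply: vf_fadd; exact: vf_fscale.
Qed.

End Combination.

Lemma three_form_eq (R : realType) (w w' : field R -> field R -> field R -> S3 R -> R) :
  (forall X Y Z, vf X -> vf Y -> vf Z -> w X Y Z = w' X Y Z) ->
  three_form w -> three_form w'.
Proof.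
move=> ww [sw lw aw]; split=> [X Y Z vX vY vZ|f X X' Y Z sf vX vX' vY vZ p|X Y vX vY p].
- by rewrite -ww//; exact: sw.
- have vXX' := vf_fadd (vf_fscale sf vX) vX'; rewrite -!ww//; exact: lw.
- by rewrite -!ww//; exact: aw.
Qed.

(** * Components in an abstract frame [e], later taken to be [E] *)

Section Frame.
Variables (R : realType) (e : 'I_3 -> field R).
Hypothesis vfe : forall k, vf (e k).
Hypothesis gee : forall j k p, g (e j p) (e k p) = kron R j k.
Hypothesis tangent_eqe : forall p u v, g (pt p) u = 0 -> g (pt p) v = 0 ->
  (forall k, g (e k p) u = g (e k p) v) -> u = v.
Hypothesis bracket_e : forall i j k p,
  flat (e k) (bracket (e i) (e j)) p = - 2 * eps R i j k.
Implicit Types (X Y Z : field R) (p : S3 R) (f : S3 R -> R).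

Local Notation co X p := (fun k : 'I_3 => flat (e k) X p).

Lemma smooth_co k X : vf X -> smooth (flat (e k) X).
Proof. by move=> vX; exact: smooth_gf. Qed.

Lemma combK X : vf X -> X = comb (fun k => flat (e k) X) e.
Proof.
move=> vX; apply/funext => p; apply: (@tangent_eqe p); first exact: vX.1.
  by rewrite g_sumr big1// => k _; rewrite gZr (vfe k).1 mulr0.
move=> k; rewrite g_sumr.
by under eq_bigr do rewrite gZr gee; rewrite sum_kron.
Qed.

Lemma gf_co X Y p : vf X -> gf X Y p = \sum_k flat (e k) X p * flat (e k) Y p.
Proof.
move=> vX; rewrite /gf [in LHS](combK vX) gC g_sumr; apply: eq_bigr => k _.
by rewrite gZr gC.
Qed.

Lemma flat_fsub k X Y p :
  flat (e k) (fsub X Y) p = flat (e k) X p - flat (e k) Y p.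
Proof. by rewrite /flat /gf /fsub gDr gNr. Qed.

Section Connection.
Variables (nabla : conn R) (hn : affine_connection nabla).

Definition chris (i j k : 'I_3) (p : S3 R) : R :=
  flat (e k) (nabla (e i) (e j)) p.

Lemma vf_conn X Y : vf X -> vf Y -> vf (nabla X Y).
Proof. by have [+ _ _ _ _] := hn; apply. Qed.

(** By the Leibniz axiom [act X f] is a component of [nabla X (fscale f (e i0))] up to a smooth
    correction, and [nabla] preserves smooth fields. *)
Lemma smooth_act X f : vf X -> smooth f -> smooth (act X f).
Proof.
move=> vX sf; have [_ _ _ _ nZ] := hn.
rewrite (_ : act X f = (fun p => flat (e i0) (nabla X (fscale f (e i0))) p
  - f p * flat (e i0) (nabla X (e i0)) p)).
  apply: smoothB; first by apply/smooth_co/vf_conn => //; exact: vf_fscale.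
  by apply: smoothM => //; apply/smooth_co/vf_conn.
apply/funext => p; rewrite nZ// /flat /gf /fadd /fscale gDr !gZr gee /kron eqxx.
by rewrite mulr1 addrK.
Qed.

Lemma flat_conn X Y k p : vf X -> vf Y ->
  flat (e k) (nabla X Y) p = act X (flat (e k) Y) p +
    \sum_i \sum_j flat (e i) X p * flat (e j) Y p * chris i j k p.
Proof.
move=> vX vY; have sX l := smooth_co l vX; have sY l := smooth_co l vY.
rewrite [in LHS](combK vY) /flat /gf conn_combr// g_sumr.
under eq_bigr do rewrite gDr !gZr gee.
rewrite big_split /= sum_kron; congr (_ + _).
rewrite exchange_big /=; apply: eq_bigr => j _.
rewrite [in LHS](combK vX) conn_combl// g_sumr mulr_sumr; apply: eq_bigr => i _.
by rewrite gZr mulrCA mulrA.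
Qed.

(** The inner products of frame fields are constant, so their derivatives vanish. *)
Lemma metric_chris i j k p : metric nabla -> chris i j k p = - chris i k j p.
Proof.
move=> mn; have := mn (e i) (e j) (e k) (vfe _) (vfe _) (vfe _) p.
rewrite (_ : gf (e j) (e k) = fun _ => kron R j k); last first.
  by apply/funext => q; exact: gee.
rewrite /act dirder_cst /gf gC -/(chris i j k p) => /esym/eqP.
by rewrite addr_eq0 => /eqP.
Qed.

(* [c = 0] is the flat connection making the frame parallel, [c = -1] the
   Levi-Civita connection. *)
Definition cross_conn (c : R) := forall X Y, vf X -> vf Y -> forall k p,
  flat (e k) (nabla X Y) p =
    act X (flat (e k) Y) p + c * cross (co X p) (co Y p) k.

Lemma cross_connP c : (forall i j k p, chris i j k p = c * eps R i j k) ->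
  cross_conn c.
Proof.
move=> h X Y vX vY k p; rewrite flat_conn//; congr (_ + _).
rewrite -sum_eps mulr_sumr; apply: eq_bigr => i _.
by rewrite mulr_sumr; apply: eq_bigr => j _; rewrite h mulrCA.
Qed.

End Connection.

(** * The Levi-Civita connection in the frame *)

Section LeviCivita.
Variables (nablag : conn R) (hg : levi_civita nablag).

(** The difference [H] of the two sides is skew in the last two indices, as the connection is
    metric, and symmetric in the first two, as it is torsion-free and the brackets are -2 [eps].
    Hence [koszul] applies. *)
Lemma lc_chris i j k p : chris nablag i j k p = -1 * eps R i j k.
Proof.
have [an mn tn] := hg; apply/eqP; rewrite mulN1r -addr_eq0; apply/eqP.
pose H i j k := chris nablag i j k p + eps R i j k; rewrite -/(H i j k).
apply: koszul => {i j k} i j k; rewrite /H.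
  by rewrite (metric_chris _ _ _ _ mn) opprD (eps_cyc _ i j k) (epsC _ j k i) -eps_cyc.
have h : chris nablag i j k p - chris nablag j i k p - - 2 * eps R i j k = 0.
  rewrite -(bracket_e i j k p) /chris -!flat_fsub -/(torsion _ _ _) /flat /gf tn// gC.
  exact: g0l.
by rewrite [eps R j i k]epsC; lra.
Qed.

Lemma lc_cross_conn : cross_conn nablag (-1).
Proof. by have [an _ _] := hg; apply: cross_connP => // i j k p; exact: lc_chris. Qed.

Lemma lc_bracketE X Y : vf X -> vf Y ->
  bracket X Y = fsub (nablag X Y) (nablag Y X).
Proof.
move=> vX vY; have [_ _ tn] := hg; apply/funext => p; apply/eqP.
by rewrite -subr_eq0 -opprB oppr_eq0; apply/eqP; exact: tn.
Qed.

(** The bracket is defined through ambient coordinates; its tangency and smoothness are read off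
    from the torsion-free identity for [nablag]. *)
Lemma vf_bracket X Y : vf X -> vf Y -> vf (bracket X Y).
Proof.
by move=> vX vY; rewrite lc_bracketE//; have [an _ _] := hg;
  apply: vf_fsub; exact: vf_conn.
Qed.

Lemma flat_bracket X Y k p : vf X -> vf Y ->
  flat (e k) (bracket X Y) p = act X (flat (e k) Y) p - act Y (flat (e k) X) p
    - 2 * cross (co X p) (co Y p) k.
Proof.
move=> vX vY; rewrite lc_bracketE// flat_fsub !lc_cross_conn// (crossC (co Y p)).
move: (act X _ p) (act Y _ p) (cross _ _ _) => a b c; ring.
Qed.

Lemma act_commutator X Y f p : vf X -> vf Y -> smooth f ->
  act (bracket X Y) f p = act X (act Y f) p - act Y (act X f) p.
Proof. by move=> vX vY sf; apply: act_bracket => //; exact: (vf_bracket vX vY).1. Qed.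

Lemma act_cross X (y z : 'I_3 -> S3 R -> R) k p : vf X ->
  (forall i, smooth (y i)) -> (forall i, smooth (z i)) ->
  act X (fun q => cross (y ^~ q) (z ^~ q) k) p =
    cross (fun i => act X (y i) p) (z ^~ p) k +
    cross (y ^~ p) (fun i => act X (z i) p) k.
Proof.
move=> vX sy sz; have pX := vX.1 p; rewrite /act.
(* Each of the three components of the cross product is an instance of this expression. *)
have main i j : dirder (fun q => y i q * z j q - y j q * z i q) p (X p) =
  dirder (y i) p (X p) * z j p - dirder (y j) p (X p) * z i p +
  (y i p * dirder (z j) p (X p) - y j p * dirder (z i) p (X p)).
  by rewrite dirderB ?dirderM//; [ring|exact: smoothM|exact: smoothM].
by elim/ord3_ind: k; exact: main.
Qed.

Lemma smooth_cross (y z : 'I_3 -> S3 R -> R) k :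
  (forall i, smooth (y i)) -> (forall i, smooth (z i)) ->
  smooth (fun q => cross (y ^~ q) (z ^~ q) k).
Proof.
move=> sy sz; have main i j : smooth (fun q => y i q * z j q - y j q * z i q).
  by apply: smoothB; exact: smoothM.
by elim/ord3_ind: k; exact: main.
Qed.

(** * Curvature of the connections X(Y) + c X x Y *)

Section CrossConnection.
Variables (nabla : conn R) (hn : affine_connection nabla) (c : R).
Hypothesis hc : cross_conn nabla c.

Lemma flat_conn_conn X Y Z k p : vf X -> vf Y -> vf Z ->
  flat (e k) (nabla X (nabla Y Z)) p =
    act X (act Y (flat (e k) Z)) p
    + c * (cross (fun i => act X (flat (e i) Y) p) (co Z p) k
           + cross (co Y p) (fun i => act X (flat (e i) Z) p) k)
    + c * (cross (co X p) (fun i => act Y (flat (e i) Z) p) k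
           + c * cross (co X p) (cross (co Y p) (co Z p)) k).
Proof.
move=> vX vY vZ; rewrite hc//; last exact: vf_conn.
have sY i := smooth_co i vY; have sZ i := smooth_co i vZ.
rewrite (_ : flat (e k) (nabla Y Z) = (fun q => act Y (flat (e k) Z) q +
    c * cross (co Y q) (co Z q) k)); last by apply/funext => q; exact: hc.
have scr := smooth_cross k sY sZ.
have sc := smoothM (smooth_cst c) scr.
have sYZ := smooth_act hn vY (sZ k).
rewrite {1}/act dirderD//; last exact: vX.1.
rewrite dirderM//; [|exact: smooth_cst|exact: vX.1].
rewrite dirder_cst mulr0 addr0 -!/(act X _ p).
rewrite (act_cross _ _ vX sY sZ).
rewrite (_ : (fun i => flat (e i) (nabla Y Z) p) = (fun i => act Y (flat (e i) Z) p +
    c * cross (co Y p) (co Z p) i)); last by apply/funext => i; exact: hc.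
rewrite /act; congr (_ + _ + c * _); exact: crossDr.
Qed.

Lemma flat_curvature X Y Z k p : vf X -> vf Y -> vf Z ->
  flat (e k) (curvature nabla X Y Z) p =
    (c ^+ 2 + 2 * c) * cross (cross (co X p) (co Y p)) (co Z p) k.
Proof.
move=> vX vY vZ; rewrite /curvature !flat_fsub !flat_conn_conn//.
rewrite hc//; last exact: vf_bracket.
rewrite act_commutator//; last exact: smooth_co.
rewrite (_ : (fun i => flat (e i) (bracket X Y) p) = (fun i =>
   act X (flat (e i) Y) p - act Y (flat (e i) X) p
    - 2 * cross (co X p) (co Y p) i)); last first.
  by apply/funext => i; exact: flat_bracket.
exact: curvature_algebra.
Qed.

Lemma Ric_cross Y Z p : vf Y -> vf Z ->
  \sum_k gf (curvature nabla (e k) Y Z) (e k) p = - 2 * (c ^+ 2 + 2 * c) * gf Y Z p.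
Proof.
move=> vY vZ; rewrite gf_co// -trace_cross; apply: eq_bigr => k _.
rewrite /gf gC -/(gf _ _ p) -/(flat _ _ p) flat_curvature//.
by rewrite (_ : (fun i => flat (e i) (e k) p) = kron R k)//; apply/funext => i;
  rewrite /flat /gf gC gee.
Qed.

End CrossConnection.

(** * Connections with constant symbols compared with Levi-Civita *)

Section Difference.
Variables (nabla : conn R) (hn : affine_connection nabla) (o : S3 R).
Hypothesis chris_cst : forall i j k p q, chris nabla i j k p = chris nabla i j k q.

(** The Levi-Civita symbols are minus [eps], so this is the difference tensor of the two
    connections; [o] is an arbitrary point at which the constants are read. *)
Definition diff_chris (i j k : 'I_3) : R := chris nabla i j k o + eps R i j k.

Lemma flat_conn_diff X Y k p : vf X -> vf Y ->
  flat (e k) (nabla X Y) p = flat (e k) (nablag X Y) p +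
    \sum_i \sum_j flat (e i) X p * flat (e j) Y p * diff_chris i j k.
Proof.
move=> vX vY; rewrite flat_conn// lc_cross_conn// -addrA; congr (_ + _).
rewrite mulN1r -sum_eps addrC; apply/esym/eqP; rewrite subr_eq; apply/eqP.
rewrite -big_split; apply: eq_bigr => i _ /=.
rewrite -big_split; apply: eq_bigr => j _ /=.
by rewrite -mulrDr /diff_chris (chris_cst i j k p o).
Qed.

Lemma metric_diff_chris i j k : metric nabla ->
  diff_chris i j k = - diff_chris i k j.
Proof.
move=> mn; rewrite /diff_chris (metric_chris _ _ _ _ mn) opprD; congr (_ + _).
by rewrite [LHS]eps_cyc epsC -eps_cyc.
Qed.

Definition tensor_conn (t : 'I_3 -> 'I_3 -> R) :=
  forall X Y, vf X -> vf Y -> forall k p,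
    flat (e k) (nabla X Y) p = flat (e k) (nablag X Y) p +
      cross (fun l => \sum_i t i l * flat (e i) X p) (co Y p) k.

Lemma metric_tensor_conn : metric nabla -> exists t, tensor_conn t.
Proof.
move=> mn; have [t ht] := skew23E (fun i j k => metric_diff_chris i j k mn).
exists t => X Y vX vY k p; rewrite flat_conn_diff//; congr (_ + _).
rewrite -tensor_cross; apply: eq_bigr => i _; apply: eq_bigr => j _.
by rewrite ht.
Qed.

Lemma tensor_conn_metric t : tensor_conn t -> metric nabla.
Proof.
move=> ht X Y Z vX vY vZ p; have [an mn _] := hg.
rewrite mn// !gf_co//; try exact: vf_conn.
by apply: (eq_sum_cross (a := fun l => \sum_i t i l * flat (e i) X p)) => k; exact: ht.
Qed.

Definition skew_conn (r : R) := forall X Y, vf X -> vf Y -> forall k p,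
  flat (e k) (nabla X Y) p =
    flat (e k) (nablag X Y) p + r * cross (co X p) (co Y p) k.

Lemma skew_conn_cross r : skew_conn r -> cross_conn nabla (r - 1).
Proof.
move=> hr X Y vX vY k p; rewrite hr// lc_cross_conn// -addrA -mulrDl.
by rewrite [-1 + r]addrC.
Qed.

(** With the bracket expressed through [nablag], the torsion is the antisymmetrised difference
    tensor. *)
Lemma flat_torsion X Y k p : vf X -> vf Y ->
  flat (e k) (torsion nabla X Y) p =
    flat (e k) (nabla X Y) p - flat (e k) (nablag X Y) p
    - (flat (e k) (nabla Y X) p - flat (e k) (nablag Y X) p).
Proof.
move=> vX vY; rewrite /torsion lc_bracketE// !flat_fsub !opprB.
by rewrite addrACA [RHS]addrACA; congr (_ + _); exact: addrC.
Qed.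

(** Metricity makes the difference tensor skew in its last two indices. Together with skewness of
    the torsion form in its last two arguments this forces total skewness, so [skew3E] leaves one
    parameter. *)
Lemma skew_torsion_conn : metric nabla -> skew_torsion nabla ->
  exists r, skew_conn r.
Proof.
move=> mn [_ lin alt]; have s23 i j k := metric_diff_chris i j k mn.
(* Expands w(X, Y + Z, Y + Z) = 0. The factors 1 come from [three_form], whose linearity is stated
   for [f X + X']. *)
have polarization (s a b y1 y2 z1 z2 : R) : s = 0 -> s = 1 * a + b ->
    a = 1 * y1 + y2 -> b = 1 * z1 + z2 -> y1 = 0 -> z2 = 0 -> y2 = - z1 by lra.
have vDe X Y : vf X -> vf Y -> vf (fadd (fscale (fun _ => 1) X) Y).
  by move=> vX vY; apply: vf_fadd => //; apply: vf_fscale => //; exact: smooth_cst.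
pose w X Y Z := gf (torsion nabla X Y) Z o.
have w23 X Y Z : vf X -> vf Y -> vf Z -> w X Y Z = - w X Z Y.
  move=> vX vY vZ; have vYZ := vDe _ _ vY vZ.
  have [_ h _] := alt X _ vX vYZ o.
  have s1 := smooth_cst (1 : R).
  have [_ h1 _] := lin _ _ _ _ _ s1 vY vZ vX vYZ o.
  have [_ _ h2] := lin _ _ _ _ _ s1 vY vZ vX vY o.
  have [_ _ h3] := lin _ _ _ _ _ s1 vY vZ vX vZ o.
  have [_ h4 _] := alt X Y vX vY o.
  have [_ h5 _] := alt X Z vX vZ o.
  exact: polarization h h1 h2 h3 h4 h5.
have wE i j k : w (e i) (e j) (e k) = diff_chris i j k - diff_chris j i k.
  rewrite /w /gf gC -[LHS]/(flat (e k) _ o) flat_torsion// /diff_chris.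
  by rewrite -!/(chris _ _ _ _ _) !lc_chris; ring.
have t13 i j k : diff_chris i j k = - diff_chris k j i.
  have := w23 (e j) (e i) (e k) (vfe _) (vfe _) (vfe _); rewrite !wE.
  by have := s23 j i k; have := s23 i k j; have := s23 k i j; lra.
exists (diff_chris i0 i1 i2) => X Y vX vY k p; rewrite flat_conn_diff//.
congr (_ + _); rewrite -sum_eps mulr_sumr; apply: eq_bigr => i _.
rewrite mulr_sumr; apply: eq_bigr => j _.
by rewrite (skew3E s23 t13) mulrCA.
Qed.

(** In components the torsion form is [2 * r] times the determinant [triple]. *)
Lemma skew_conn_torsion r : skew_conn r -> skew_torsion nabla.
Proof.
move=> hr.
have wE X Y Z : vf X -> vf Y -> vf Z -> gf (torsion nabla X Y) Z =
    (fun p => 2 * r * triple (co X p) (co Y p) (co Z p)).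
  move=> vX vY vZ; apply/funext => p; rewrite /gf gC -/(gf _ _ p) gf_co// mulr_sumr.
  apply: eq_bigr => k _; rewrite flat_torsion// !hr// (crossC (co Y p)).
  move: (cross _ _ _) (flat (e k) (nablag _ _) p) => a b.
  move: (flat (e k) (nablag _ _) p) (flat _ _ _) => c d; ring.
apply: (three_form_eq (fun X Y Z vX vY vZ => esym (wE X Y Z vX vY vZ))).
have coD f X Y p : co (fadd (fscale f X) Y) p =
    (fun k => f p * flat (e k) X p + flat (e k) Y p).
  by apply/funext => k; rewrite /flat /gf /fadd /fscale gDr gZr.
split.
- move=> X Y Z vX vY vZ; apply: smoothM; first exact: smooth_cst.
  rewrite /triple; under eq_fun do rewrite sum3.
  have sc k := smooth_cross k (fun i => smooth_co i vX) (fun i => smooth_co i vY).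
  have sZ k := smooth_co k vZ.
  exact: smoothD (smoothD (smoothM (sc _) (sZ _)) (smoothM (sc _) (sZ _)))
    (smoothM (sc _) (sZ _)).
- move=> f X X' Y Z sf vX vX' vY vZ p; rewrite coD.
  have lin (a b c k : R) : a = k * b + c -> 2 * r * a = k * (2 * r * b) + 2 * r * c.
    by move=> ->; ring.
  have [t1 t2 t3] := triple_linear (f p) (co X p) (co X' p) (co Y p) (co Z p).
  by split; apply: lin.
- move=> X Y vX vY p; have [t1 t2 t3] := triple_alt (co X p) (co Y p).
  have z (a : R) : a = 0 -> 2 * r * a = 0 by move=> ->; rewrite mulr0.
  by split; apply: z.
Qed.

End Difference.

End LeviCivita.
End Frame.

(** * Invariance *)

Section Invariance.
Variable R : realType.
Implicit Types (p q : S3 R) (s : SU2 R).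

Lemma base_unit : g (base R) (base R) == 1.
Proof. by rewrite gE !mxE /=; apply/eqP; ring. Qed.

Definition origin : S3 R := exist _ (base R) base_unit.

(** The element of SU(2) that carries [origin] to [p]. *)
Definition transport p : SU2 R := exist _ (su2_of p) (su2_ofP p).

Lemma su2_unit s : su2mx s \in unitmx.
Proof. by have /andP[us _] := valP s; exact: unitarymx_unit. Qed.

Lemma transportK p : tau (su2_inv (transport p)) p = origin.
Proof.
apply: val_inj; rewrite /= -/(su2mx (su2_inv _)) -[RHS]/(base R).
rewrite su2_invE; transitivity (invmx (su2_of p) *m (su2_of p *m base R)).
  by rewrite su2_ofK.
by rewrite mulKmx//; exact: (su2_unit (transport p)).
Qed.

Lemma su2_mulP s p :
  (su2mx s *m su2_of p \is unitarymx) && (\det (su2mx s *m su2_of p) == 1).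
Proof.
have /andP[us /eqP ds] := valP s; have /andP[uq /eqP dq] := su2_ofP p.
apply/andP; split; first exact: mul_unitarymx us uq.
rewrite det_mulmx -[X in _ == X]mulr1; apply/eqP.
by congr (_ * _); [exact: ds|exact: dq].
Qed.

Definition su2_mul s p : SU2 R :=
  exist (fun A : 'M[R[i]]_2 => (A \is unitarymx) && (\det A == 1)) _ (su2_mulP s p).

Lemma push_left_field s A : push s (left_field A) = left_field A :> field R.
Proof.
apply/funext => p; pose q := tau (su2_inv s) p.
(* The product of [s] with the group element over [q] sends the base point to [p], so it may
   represent [p] in the left-invariant field. *)
rewrite (@left_fieldE R A (su2_mul s q) p).
  by rewrite /push -/q /left_field /su2mx /= !mulmxA.
rewrite /su2mx /= -mulmxA su2_ofK /pt /= -/(su2mx (su2_inv s)) su2_invE.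
by rewrite mulKVmx//; exact: su2_unit.
Qed.

Lemma push_E s k : push s (E k) = E k :> field R.
Proof. by elim/ord3_ind: k; exact: push_left_field. Qed.

(** Pushing forward by [transport x] fixes the frame and preserves [g], so each symbol at [x] equals
    its value at [origin]. *)
Lemma chris_cst (nabla : conn R) i j k p q : SU2_invariant nabla ->
  chris (@E R) nabla i j k p = chris (@E R) nabla i j k q.
Proof.
move=> inv; suff h x : chris (@E R) nabla i j k x = chris (@E R) nabla i j k origin.
  by rewrite h [RHS]h.
rewrite /chris /flat /gf -{1}(push_E (transport x) k).
have -> : nabla (E i) (E j) x = push (transport x) (nabla (E i) (E j)) x.
  by rewrite inv ?push_E//; exact: vf_E.
rewrite /push transportK g_unitary//.
by have /andP[] := valP (transport x).
Qed.

End Invariance.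

(** * The Sasakian tensors in the frame *)

Section SphereTensors.
Variable R : realType.
Implicit Types (X Y : field R) (p : S3 R).

Local Notation co X p := (fun k : 'I_3 => flat (E k) X p).

Lemma g_E_sigma j k Y p : g (E k p) (sigma j Y p) = cross (kron R j) (co Y p) k.
Proof.
pose y : 'I_3 -> R := co Y p.
have main a b : g (E k p) (wedge (E a) (E b) Y p) =
    y a * kron R k b - y b * kron R k a.
  by rewrite /wedge /fsub /fscale gDr gNr !gZr !gEE.
transitivity (g (E k p) (tnth [tuple wedge (E i1) (E i2); wedge (E i2) (E i0);
    wedge (E i0) (E i1)] j Y p)); first by elim/ord3_ind: j.
rewrite -/y; clearbody y; elim/ord3_ind: j; rewrite [LHS]main;
  elim/ord3_ind: k {main}; rewrite /kron /cross /tnth /=; ring.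
Qed.

Lemma xiE : @xi R = (fun p => - E i2 p).
Proof. by apply/funext => p; rewrite E_lin. Qed.

Lemma g_imul u v : g (imul u) v = - g u (imul v) :> R.
Proof.
rewrite !gE !mxE.
by case: (u 0 0) (u 1 0) (v 0 0) (v 1 0) => [? ?] [? ?] [? ?] [? ?] /=; ring.
Qed.

Lemma etaE X p : eta X p = - flat (E i2) X p.
Proof. by rewrite /eta g_imul /flat /gf [in RHS]gC E_lin. Qed.

(** Multiplication by i is skew and sends E1, E2, E3 to E2, -E1 and minus the normal, so the
    components of [psi X] are those of [X] rotated in the plane of E1 and E2. *)
Lemma g_E_psi k X p : vf X -> g (E k p) (psi X p) =
  tnth [tuple - flat (E i1) X p; flat (E i0) X p; 0] k.
Proof.
move=> vX; rewrite /psi gDr gNr gZr (gC _ (pt p)) gpE mulr0 subr0 gC g_imul gC.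
elim/ord3_ind: k; rewrite /tnth /=.
- by rewrite /flat /gf !E_lin.
- have -> : imul (E i1 p) = - E i0 p.
    rewrite !E_lin /Elin /tnth /= /imul scalerA.
    rewrite (_ : _ * _ = -1) ?scaleN1r//.
    by apply/eqP; rewrite eq_complex /=; apply/andP; split; apply/eqP; ring.
  by rewrite gNl opprK.
- have -> : imul (E i2 p) = - pt p.
    rewrite !E_lin /Elin /tnth /= /imul scalerA.
    rewrite (_ : _ * _ = -1) ?scaleN1r//.
    by apply/eqP; rewrite eq_complex /=; apply/andP; split; apply/eqP; ring.
  by rewrite gNl opprK vX.1.
Qed.

Lemma PhiE X Y p : vf X -> vf Y -> Phi X Y p =
  - (flat (E i0) X p * flat (E i1) Y p - flat (E i1) X p * flat (E i0) Y p).
Proof.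
move=> vX vY; rewrite /Phi /gf (g_tangent _ (vX.1 p)).
under eq_bigr do rewrite g_E_psi//.
have gen (x y : 'I_3 -> R) : \sum_k x k * tnth [tuple - y i1; y i0; 0] k =
    - (x i0 * y i1 - x i1 * y i0).
  by rewrite sum3 /tnth /=; ring.
exact: (gen (co X p) (co Y p)).
Qed.

Lemma psi_tangent X p : g (pt p) (psi X p) = 0.
Proof. by rewrite /psi gDr gNr gZr pt_unit mulr1 gC /eta subrr. Qed.

Lemma g_comb3 w u v t (a b c : R) :
  g w (rscale a u - rscale b v + rscale c t) = a * g w u - b * g w v + c * g w t.
Proof. by rewrite gDr gDr gNr gZr gZr gZr. Qed.

Definition skew_tensor X Y p := rscale (Phi X Y p) (xi p)
  - rscale (eta X p) (psi Y p) + rscale (eta Y p) (psi X p).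

Lemma skew_tensor_tangent X Y p : g (pt p) (skew_tensor X Y p) = 0.
Proof.
rewrite /skew_tensor g_comb3 xiE gNr gpE oppr0.
have gen (a b c u v : R) : u = 0 -> v = 0 -> a * 0 - b * u + c * v = 0.
  by move=> -> ->; ring.
by apply: gen; exact: psi_tangent.
Qed.

(** The [Phi] term gives the E3 component of the cross product, since [xi] is -E3; the two [eta]
    terms give the other two components. *)
Lemma g_E_skew_tensor X Y k p : vf X -> vf Y ->
  g (E k p) (skew_tensor X Y p) = cross (co X p) (co Y p) k.
Proof.
move=> vX vY; rewrite /skew_tensor g_comb3.
have gen (x y : 'I_3 -> R) (a b c w u v : R) :
    a = - (x i0 * y i1 - x i1 * y i0) -> b = - x i2 -> c = - y i2 ->
    w = - kron R k i2 -> u = tnth [tuple - y i1; y i0; 0] k ->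
    v = tnth [tuple - x i1; x i0; 0] k -> a * w - b * u + c * v = cross x y k.
  move=> -> -> -> -> -> ->.
  by rewrite /kron /cross; elim/ord3_ind: k; rewrite /tnth /=; ring.
apply: (gen (co X p) (co Y p)).
- exact: PhiE.
- exact: etaE.
- exact: etaE.
- by rewrite xiE gNr gEE.
- exact: g_E_psi.
- exact: g_E_psi.
Qed.

Lemma sigma_tangent j Y p : g (pt p) (sigma j Y p) = 0.
Proof.
have main a b : g (pt p) (wedge (E a) (E b) Y p) = 0.
  by rewrite /wedge /fsub /fscale gDr gNr !gZr !gpE !mulr0 subr0.
by elim/ord3_ind: j; [exact: (main i1 i2)|exact: (main i2 i0)|exact: (main i0 i1)].
Qed.

End SphereTensors.

(** * From frame components back to the global formulas *)

Section Formulas.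
Variables (R : realType) (nablag nabla : conn R).
Hypotheses (an : affine_connection nabla) (ag : affine_connection nablag).

(** Both sides of the formula are tangent, so they agree once their frame components do; in
    components [sigma j] is the cross product with the j-th basis vector. *)
Lemma tensor_connE t : tensor_conn (@E R) nablag nabla t <->
  forall X Y : field R, vf X -> vf Y -> forall p : S3 R,
    nabla X Y p = nablag X Y p +
      \sum_(i < 3) \sum_(j < 3) rscale (t i j * flat (E i) X p) (sigma j Y p).
Proof.
have gsum w X Y p : g w (\sum_(i < 3) \sum_(j < 3)
      rscale (t i j * flat (E i) X p) (sigma j Y p)) =
    \sum_(i < 3) \sum_(j < 3) t i j * flat (E i) X p * g w (sigma j Y p).
  by rewrite g_sumr; under eq_bigr do (rewrite g_sumr; under eq_bigr do rewrite gZr).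
have coE X Y k p : g (E k p) (\sum_(i < 3) \sum_(j < 3)
      rscale (t i j * flat (E i) X p) (sigma j Y p)) =
    cross (fun l => \sum_i t i l * flat (E i) X p) (fun i => flat (E i) Y p) k.
  rewrite gsum; under eq_bigr do under eq_bigr do rewrite g_E_sigma.
  exact: (sum_cross_kron t (fun i => flat (E i) X p)).
split=> h X Y vX vY.
  move=> p; apply: tangent_eq; first exact: (vf_conn an vX vY).1.
    rewrite gDr (vf_conn ag vX vY).1 add0r gsum.
    by rewrite big1// => i _; rewrite big1// => j _; rewrite sigma_tangent mulr0.
  by move=> k; rewrite gDr coE; exact: h.
by move=> k p; rewrite -coE {1}/flat {1}/gf h// gDr.
Qed.

Lemma skew_connE r : skew_conn (@E R) nablag nabla r <-> skew_formula nablag nabla r.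
Proof.
split=> h X Y vX vY.
  move=> p; apply: tangent_eq; first exact: (vf_conn an vX vY).1.
    by rewrite gDr (vf_conn ag vX vY).1 add0r gZr skew_tensor_tangent mulr0.
  by move=> k; rewrite gDr gZr g_E_skew_tensor//; exact: h.
by move=> k p; rewrite -g_E_skew_tensor// -gZr {1}/flat {1}/gf h// gDr.
Qed.

End Formulas.

Theorem theorem7p1 (R : realType) (nablag : conn R)
    (hg : levi_civita nablag) (nabla : conn R)
    (hconn : affine_connection nabla) (hinv : SU2_invariant nabla) :
  [/\ metric nabla <->
        (exists t : 'I_3 -> 'I_3 -> R,
          forall X Y : field R, vf X -> vf Y -> forall p : S3 R,
            nabla X Y p = nablag X Y p +
              \sum_(i < 3) \sum_(j < 3)
                 rscale (t i j * flat (E i) X p) (sigma j Y p)),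
      metric nabla ->
        (skew_torsion nabla <-> exists r : R, skew_formula nablag nabla r) &
      metric nabla -> skew_torsion nabla ->
        nabla_Einstein nabla /\
        forall r : R, skew_formula nablag nabla r ->
          forall Y Z : field R, vf Y -> vf Z -> forall p : S3 R,
            SymRic nabla Y Z p = 2 * (1 - r ^+ 2) * gf Y Z p].
Proof.
have [ag _ _] := hg.
have cst i j k p q : chris (@E R) nabla i j k p = chris (@E R) nabla i j k q.
  exact: chris_cst.
have vfE := @vf_E R; have gE' := @gEE R; have tE := @tangent_eq R.
have bE := @bracket_E R.
have skew_ex : metric nabla -> skew_torsion nabla ->
    exists r : R, skew_formula nablag nabla r.
  move=> mn sn.
  have [r hr] := skew_torsion_conn vfE gE' tE bE hg hconn (origin R) cst mn sn.
  by exists r; apply/skew_connE.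
have ricE r : skew_formula nablag nabla r -> forall Y Z, vf Y -> vf Z -> forall p,
    Ric nabla Y Z p = 2 * (1 - r ^+ 2) * gf Y Z p.
  move=> /(skew_connE hconn ag) hr Y Z vY vZ p.
  have hc := skew_conn_cross vfE gE' tE bE hg hr.
  rewrite /Ric (Ric_cross vfE gE' tE bE hg hconn hc)//.
  (* With [c = r - 1] one has [c ^+ 2 + 2 * c = r ^+ 2 - 1]. *)
  by congr (_ * _); ring.
have symE r : skew_formula nablag nabla r -> forall Y Z, vf Y -> vf Z -> forall p,
    SymRic nabla Y Z p = 2 * (1 - r ^+ 2) * gf Y Z p.
  move=> hr Y Z vY vZ p; rewrite /SymRic !(ricE r hr)//.
  have -> : gf Z Y p = gf Y Z p by exact: gC.
  by field.
split.
- split=> [mn|[t ht]].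
    have [t ht] := metric_tensor_conn vfE gE' tE bE hg hconn (origin R) cst mn.
    by exists t; apply/tensor_connE.
  exact: (tensor_conn_metric vfE gE' tE hg hconn ((tensor_connE hconn ag t).2 ht)).
- move=> mn; split=> [|[r hr]]; first exact: skew_ex.
  exact: (skew_conn_torsion vfE gE' tE hg ((skew_connE hconn ag r).2 hr)).
- move=> mn sn; split=> // Y Z vY vZ p.
  have [r hr] := skew_ex mn sn; rewrite (symE r hr)//; congr (_ * _).
  (* The frame is orthonormal, so the scalar curvature is three times the Einstein factor. *)
  rewrite /scal (eq_bigr (fun=> 2 * (1 - r ^+ 2))); first by rewrite sum3; field.
  by move=> k _; rewrite (ricE r hr)// /gf gEE eqxx mulr1.
Qed.
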